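(* There is no self-shrinker $x:M^2\to\mathbb{C}^2$ with constant Kähler angle $\theta\in(0,\pi)$ such that $M^2$ has the topology of a sphere (i.e. $M^2$ is homeomorphic to $S^2$).
   Context: $\mathbb{C}^2$ has coordinates $z_k=x_k+\sqrt{-1}\,y_k$ ($k=1,2$), the Euclidean metric $\langle\cdot,\cdot\rangle$, the canonical complex structure $\mathbf{J}\frac{\partial}{\partial x_k}=\frac{\partial}{\partial y_k}$, $\mathbf{J}\frac{\partial}{\partial y_k}=-\frac{\partial}{\partial x_k}$, and the Kähler form $\omega$ determined by $\langle U,V\rangle=\omega(U,\mathbf{J}V)$. Let $x:M^2\to\mathbb{C}^2$ be a smooth immersion of an oriented surface, with induced metric and volume form $dV_M$. The Kähler angle $\theta:M\to[0,\pi]$ of $x$ is defined by $x^*\omega=\cos\theta\, dV_M$; equivalently $\cos\theta=\langle\mathbf{J}(x_*e_1),x_*e_2\rangle$ for any oriented orthonormal tangent frame $\{e_1,e_2\}$. The mean curvature vector is the trace of the second fundamental form $h$: $H=h(e_1,e_1)+h(e_2,e_2)$. The immersion $x$ is a self-shrinker if $H=-x^\perp$, where $^\perp$ is the orthogonal projection of the position vector to the normal bundle of $x$. *)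

(* Defs.v *)
From HB Require Import structures.
From mathcomp Require Import all_boot all_order all_algebra.
From mathcomp Require Import all_classical all_reals all_analysis.
From mathcomp Require Import ring.

Set Implicit Arguments.
Unset Strict Implicit.
Unset Printing Implicit Defensive.
Import Order.TTheory GRing.Theory Num.Theory.
Import numFieldNormedType.Exports.

Local Open Scope classical_set_scope.
Local Open Scope ring_scope.

Definition dot (R : realType) (n : nat) (u v : 'rV[R]_n) : R :=
  \sum_(i < n) u 0 i * v 0 i.

(* C^2 as a real vector space: the vector (z_1, z_2) with z_k = x_k + i y_k is
   the row (x_1, x_2, y_1, y_2). *)
Notation C2 R := 'rV[R]_(2 + 2).

Definition complexJ (R : realType) (v : C2 R) : C2 R :=
  row_mx (- rsubmx v) (lsubmx v).

Definition kahler_form (R : realType) (u v : C2 R) : R :=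
  dot (complexJ u) v.

Lemma kahler_formP (R : realType) (u v : C2 R) :
  dot u v = kahler_form u (complexJ v).
Proof.
rewrite /kahler_form /dot !big_split_ord /= addrC.
by congr (_ + _); apply: eq_bigr => i _;
  rewrite /complexJ ?row_mxEl ?row_mxEr !mxE ?mulrNN.
Qed.

(* Meant for open U. *)
Fixpoint Ck_on (R : realType) (V W : normedModType R) (k : nat) (U : set V)
    (f : V -> W) : Prop :=
  match k with
  | 0%N => forall q, U q -> {for q, continuous f}
  | k'.+1 => (forall q, U q -> differentiable f q) /\
             (forall v : V, Ck_on k' U ('D_v f))
  end.

Definition smooth_on (R : realType) (V W : normedModType R) (U : set V)
    (f : V -> W) : Prop := forall k, Ck_on k U f.

Definition homeomorphic_to_set (T U : topologicalType) (A : set U) : Prop :=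
  exists (f : T -> U) (g : U -> T),
    [/\ continuous f, {within A, continuous g}, forall t, A (f t),
        cancel f g & forall u, A u -> f (g u) = u].

Definition sphere2 (R : realType) : set 'rV[R]_3 := [set v | dot v v = 1].

(* The values of chart_map outside chart_dom, and of chart_inv outside
   chart_map @` chart_dom, are irrelevant. *)
Record chart (R : realType) (T : topologicalType) := Chart {
  chart_dom : set T ;
  chart_map : T -> 'rV[R]_2 ;
  chart_inv : 'rV[R]_2 -> T ;
  chart_dom_open : open chart_dom ;
  chart_img_open : open (chart_map @` chart_dom) ;
  chart_mapK : forall t, chart_dom t -> chart_inv (chart_map t) = t ;
  chart_map_continuous : {within chart_dom, continuous chart_map} ;
  chart_inv_continuous : {within chart_map @` chart_dom, continuous chart_inv}
}.

Definition transition (R : realType) (T : topologicalType) (c d : chart R T) :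
    'rV[R]_2 -> 'rV[R]_2 := chart_map d \o chart_inv c.

(* 'J f q is the matrix of 'd f q acting on row vectors: its rows are the
   partial derivatives of f. *)
Definition oriented_compatible (R : realType) (T : topologicalType)
    (c d : chart R T) : Prop :=
  let U := chart_map c @` (chart_dom c `&` chart_dom d) in
  smooth_on U (transition c d) /\
  forall q, U q -> 0 < \det ('J (transition c d) q).

Record oriented_surface (R : realType) := OrientedSurface {
  surface_space :> topologicalType ;
  surface_atlas : set (chart R surface_space) ;
  surface_hausdorff : hausdorff_space surface_space ;
  surface_second_countable : @second_countable surface_space ;
  surface_atlas_cover :
    forall p, exists2 c, surface_atlas c & chart_dom c p ;
  surface_atlas_oriented :
    forall c d, surface_atlas c -> surface_atlas d -> oriented_compatible c d
}.

(* Local geometry of a parametrized surface X at a point q; tangent vectors are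
   given by their coordinates a : 'rV[R]_2, so that X_* a = a *m 'J X q. *)
Section LocalGeometry.
Variables (R : realType) (X : 'rV[R]_2 -> C2 R) (q : 'rV[R]_2).

Definition pushforward (a : 'rV[R]_2) : C2 R := a *m 'J X q.

Definition induced_metric (a b : 'rV[R]_2) : R :=
  dot (pushforward a) (pushforward b).

Definition metric_mx : 'M[R]_2 :=
  \matrix_(i, j) induced_metric (delta_mx 0 i) (delta_mx 0 j).

Definition volume_form (a b : 'rV[R]_2) : R :=
  Num.sqrt (\det metric_mx) * \det (col_mx a b : 'M[R]_2).

Definition pullback_kahler_form (a b : 'rV[R]_2) : R :=
  kahler_form (pushforward a) (pushforward b).

(* sum_(i, j) g^ij <v, X_j> X_i *)
Definition tangent_proj (v : C2 R) : C2 R :=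
  \sum_(i < 2) \sum_(j < 2)
    (invmx metric_mx i j * dot v (pushforward (delta_mx 0 j)))
      *: pushforward (delta_mx 0 i).

Definition normal_proj (v : C2 R) : C2 R :=
  v - tangent_proj v.

(* The Levi-Civita connection of C^2 being flat, h(X_* a, X_* b) is the normal
   component of the second derivative of X along a and b. *)
Definition second_fundamental_form (a b : 'rV[R]_2) : C2 R :=
  normal_proj ('D_a ('D_b X) q).

(* The trace of h with respect to the induced metric; mean_curvature_frame
   below gives its expression in an orthonormal frame. *)
Definition mean_curvature : C2 R :=
  \sum_(i < 2) \sum_(j < 2) invmx metric_mx i j *:
    second_fundamental_form (delta_mx 0 i) (delta_mx 0 j).

Definition orthonormal_frame (e1 e2 : 'rV[R]_2) : Prop :=
  [/\ induced_metric e1 e1 = 1, induced_metric e2 e2 = 1 &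
      induced_metric e1 e2 = 0].

End LocalGeometry.

Lemma dotE (R : realType) n (u v : 'rV[R]_n) : dot u v = (u *m v^T) 0 0.
Proof. by rewrite mxE; apply: eq_bigr => i _; rewrite mxE. Qed.

Lemma det2 (R : comNzRingType) (A : 'M[R]_2) :
  \det A = A 0 0 * A 1 1 - A 0 1 * A 1 0.
Proof.
rewrite (expand_det_row _ 0) big_ord_recl big_ord1 /cofactor !det_mx11 !mxE /=.
rewrite expr0 expr1 mul1r mulN1r mulrN.
by congr (A _ _ * A _ _ - A _ _ * A _ _); apply/val_inj.
Qed.

(* Checks that the coordinate expressions above agree with the definitions in
   terms of orthogonality and of orthonormal frames. *)
Section Frames.
Variables (R : realType) (X : 'rV[R]_2 -> C2 R) (q : 'rV[R]_2).
Local Notation g := (metric_mx X q).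

Lemma metric_mxE : g = 'J X q *m ('J X q)^T.
Proof.
apply/matrixP => i j; rewrite mxE /induced_metric /pushforward -!rowE dotE.
by rewrite !mxE; apply: eq_bigr => k _; rewrite !mxE.
Qed.

Lemma induced_metricE a b : induced_metric X q a b = (a *m g *m b^T) 0 0.
Proof. by rewrite /induced_metric /pushforward dotE metric_mxE trmx_mul !mulmxA. Qed.

Lemma normal_projE v : normal_proj X q v =
  v - v *m ('J X q)^T *m (invmx g)^T *m 'J X q.
Proof.
congr (_ - _); rewrite /tangent_proj [RHS]mulmx_sum_row; apply: eq_bigr => i _.
rewrite rowE -scaler_suml; congr (_ *: _).
rewrite mxE; apply: eq_bigr => j _.
rewrite [(invmx g)^T _ _]mxE mulrC; congr (_ * _).
by rewrite /pushforward dotE -rowE !mxE; apply: eq_bigr => k _; rewrite !mxE.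
Qed.

Lemma metric_mx_unit : injective (pushforward X q) -> g \in unitmx.
Proof.
move=> inj; rewrite -row_free_unit -kermx_eq0; apply/negPn/negP => /rowV0Pn.
case=> a /sub_kermxP ag0 /negP a0; apply: a0; apply/eqP; apply: inj.
rewrite [RHS]/pushforward mul0mx.
have : induced_metric X q a a = 0 by rewrite induced_metricE ag0 mul0mx mxE.
rewrite /induced_metric /dot => /eqP; rewrite psumr_eq0; last first.
  by move=> i _; rewrite -expr2 sqr_ge0.
move=> /allP /= h; apply/rowP => i; have := h i (mem_index_enum _).
by rewrite /= -expr2 sqrf_eq0 => /eqP ->; rewrite mxE.
Qed.

Lemma normal_proj_orthogonal v a : injective (pushforward X q) ->
  dot (normal_proj X q v) (pushforward X q a) = 0.
Proof.
move=> /metric_mx_unit gu; rewrite normal_projE dotE /pushforward trmx_mul.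
have gT : g^T = g by rewrite metric_mxE trmx_mul trmxK.
rewrite trmx_inv gT mulmxA mulmxBl.
rewrite -[_ *m invmx g *m _ *m _]mulmxA -metric_mxE -!mulmxA mulVmx ?mulmx1 //.
by rewrite subrr mul0mx mxE.
Qed.

Lemma pullback_kahlerE a b : pullback_kahler_form X q a b =
  \det (col_mx a b : 'M[R]_2) *
  pullback_kahler_form X q (delta_mx 0 0) (delta_mx 0 1).
Proof.
have pD (u v w : C2 R) : kahler_form (u + v) w = kahler_form u w + kahler_form v w.
  rewrite /kahler_form /dot -big_split; apply: eq_bigr => i _.
  by rewrite /complexJ !linearD /= -add_row_mx mxE mulrDl.
have pZ k (u w : C2 R) : kahler_form (k *: u) w = k * kahler_form u w.
  rewrite /kahler_form /dot mulr_sumr; apply: eq_bigr => i _.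
  by rewrite /complexJ !linearZ /= -scale_row_mx mxE mulrA.
have alt (u w : C2 R) : kahler_form u w = - kahler_form w u.
  rewrite /kahler_form /dot !big_split_ord /= opprD addrC -!sumrN.
  by congr (_ + _); apply: eq_bigr => i _;
    rewrite /complexJ ?row_mxEl ?row_mxEr !mxE ?mulNr ?opprK mulrC.
have alt0 (u : C2 R) : kahler_form u u = 0.
  by have /eqP := alt u u; rewrite -addr_eq0 -mulr2n mulrn_eq0 /= => /eqP.
have r2 (c : 'rV[R]_2) : c = c 0 0 *: delta_mx 0 0 + c 0 1 *: delta_mx 0 1.
  rewrite {1}(row_sum_delta c) big_ord_recl big_ord1.
  by congr (_ + c 0 _ *: delta_mx 0 _); apply/val_inj.
have -> : \det (col_mx a b : 'M[R]_2) = a 0 0 * b 0 1 - a 0 1 * b 0 0.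
  rewrite det2.
  have E1 k : (col_mx a b : 'M[R]_2) 0 k = a 0 k.
    by rewrite -(col_mxEu a b 0 k); congr (col_mx a b _ _); apply/val_inj.
  have E2 k : (col_mx a b : 'M[R]_2) 1 k = b 0 k.
    by rewrite -(col_mxEd a b 0 k); congr (col_mx a b _ _); apply/val_inj.
  by rewrite !E1 !E2.
rewrite {1}(r2 a) {1}(r2 b) /pullback_kahler_form /pushforward.
rewrite !mulmxDl -!scalemxAl; set u := _ *m _; set v := delta_mx 0 1 *m _.
rewrite !pD !pZ ![kahler_form _ (_ + _)]alt !pD !pZ !alt0 [kahler_form v u]alt.
by ring.
Qed.

Variables e1 e2 : 'rV[R]_2.
Hypothesis frame : orthonormal_frame X q e1 e2.
Let E : 'M[R]_2 := col_mx e1 e2.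

Lemma frame_mxE : E *m g *m E^T = 1%:M.
Proof.
case: frame => h11 h22 h12.
have h21 : induced_metric X q e2 e1 = 0.
  by rewrite -h12 /induced_metric /dot; apply: eq_bigr => i _; rewrite mulrC.
rewrite !induced_metricE in h11 h22 h12 h21.
rewrite /E (mul_col_mx (m1:=1) (m2:=1)) (tr_col_mx (m1:=1) (m2:=1)).
rewrite (mul_col_row (m1:=1) (m2:=1) (p1:=1) (p2:=1)).
rewrite (mx11_scalar (e1 *m g *m e1^T)) (mx11_scalar (e1 *m g *m e2^T)).
rewrite (mx11_scalar (e2 *m g *m e1^T)) (mx11_scalar (e2 *m g *m e2^T)).
rewrite h11 h12 h21 h22 !raddf0; symmetry; exact: (@scalar_mx_block R 1 1).
Qed.

Lemma invmx_metric : invmx g = E^T *m E.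
Proof.
have h := frame_mxE.
have h2 : E^T *m E *m g = 1%:M by rewrite -mulmxA; apply: mulmx1C.
have [_ gu] := mulmx1_unit h2.
by rewrite -[RHS](mulmxK gu) h2 mul1mx.
Qed.

Lemma volume_form_frame : 0 < \det E -> volume_form X q e1 e2 = 1.
Proof.
move=> E0; rewrite /volume_form -/E.
have := congr1 determinant frame_mxE; rewrite !det_mulmx det_tr det1 => h.
have -> : \det g = ((\det E)^-1) ^+ 2.
  apply: (mulfI (lt0r_neq0 E0)); apply: (mulIf (lt0r_neq0 E0)).
  by rewrite h expr2 mulrA divff ?mul1r ?mulVf ?lt0r_neq0.
by rewrite sqrtr_sqr ger0_norm ?invr_ge0 ?ltW// mulVf ?lt0r_neq0.
Qed.

Lemma kahler_angle_frame t : 0 < \det E ->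
  (forall a b, pullback_kahler_form X q a b = t * volume_form X q a b) <->
  dot (complexJ (pushforward X q e1)) (pushforward X q e2) = t.
Proof.
move=> E0; split=> [h|h a b].
  by rewrite -[LHS]/(pullback_kahler_form X q e1 e2) h volume_form_frame ?mulr1.
have := volume_form_frame E0; rewrite /volume_form -/E => v1.
have := pullback_kahlerE e1 e2; rewrite [LHS]h -/E => ht.
rewrite pullback_kahlerE ht; set w := pullback_kahler_form _ _ _ _.
set s := Num.sqrt _ in v1 *; set d := \det (col_mx a b : 'M[R]_2).
by rewrite -[LHS]mulr1 -v1; ring.
Qed.

Hypothesis dX : \forall p \near q, differentiable X p.
Hypothesis d2X : forall v, differentiable ('D_v X) q.

Lemma mean_curvature_frame : mean_curvature X q =
  second_fundamental_form X q e1 e1 + second_fundamental_form X q e2 e2.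
Proof.
have D2 a b : 'D_a ('D_b X) q = \sum_(i < 2) \sum_(j < 2)
    (a 0 i * b 0 j) *: 'D_(delta_mx 0 i) ('D_(delta_mx 0 j) X) q.
  rewrite [LHS]deriveE; last exact: d2X.
  rewrite {1}(row_sum_delta a) linear_sum; apply: eq_bigr => i _.
  rewrite linearZ /= -deriveE //.
  have -> : 'D_(delta_mx 0 i) ('D_b X) q =
     'D_(delta_mx 0 i) (\sum_(j < 2) b 0 j *: 'D_(delta_mx 0 j) X) q.
    apply: near_eq_derive.
    near=> p. have dp : differentiable X p by near: p.
    rewrite deriveE // {1}(row_sum_delta b) linear_sum fct_sumE.
    by apply: eq_bigr => j _; rewrite linearZ /= fctE deriveE.
  rewrite derive_sum; last first.
    by move=> j; apply: derivableZ; apply: diff_derivable.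
  rewrite scaler_sumr; apply: eq_bigr => j _.
  by rewrite deriveZ ?scalerA//; apply: diff_derivable.
have npD : {morph normal_proj X q : u v / u + v}.
  by move=> u v; rewrite !normal_projE !mulmxDl opprD addrACA.
have npZ k : {morph normal_proj X q : u / k *: u}.
  by move=> u; rewrite !normal_projE -!scalemxAl scalerBr.
have np0 : normal_proj X q 0 = 0 by rewrite normal_projE !mul0mx subr0.
have hE a : second_fundamental_form X q a a = \sum_(i < 2) \sum_(j < 2)
    (a 0 i * a 0 j) *: second_fundamental_form X q (delta_mx 0 i) (delta_mx 0 j).
  rewrite /second_fundamental_form D2 (big_morph _ npD np0).
  apply: eq_bigr => i _; rewrite (big_morph _ npD np0).
  by apply: eq_bigr => j _; rewrite npZ.
rewrite !hE /mean_curvature -big_split; apply: eq_bigr => i _.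
rewrite -big_split; apply: eq_bigr => j _; rewrite /= -scalerDl; congr (_ *: _).
rewrite invmx_metric mxE big_ord_recl big_ord1 ![E^T _ _]mxE.
have E1 k : E 0 k = e1 0 k.
  by rewrite -(col_mxEu e1 e2 0 k); congr (E _ _); apply/val_inj.
have E2 k : E 1 k = e2 0 k.
  by rewrite -(col_mxEd e1 e2 0 k); congr (E _ _); apply/val_inj.
have -> : lift ord0 ord0 = 1 :> 'I_2 by apply/val_inj.
by rewrite -[ord0]/(0 : 'I_2) !E1 !E2.
Unshelve. all: by end_near. Qed.

End Frames.

Section Immersions.
Variables (R : realType) (M : oriented_surface R) (x : M -> C2 R).

Definition local_expr (c : chart R M) : 'rV[R]_2 -> C2 R :=
  x \o chart_inv c.

Definition smooth_immersion : Prop :=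
  forall c, surface_atlas c ->
    smooth_on (chart_map c @` chart_dom c) (local_expr c) /\
    forall p, chart_dom c p ->
      injective (pushforward (local_expr c) (chart_map c p)).

Definition self_shrinker : Prop :=
  smooth_immersion /\
  forall c p, surface_atlas c -> chart_dom c p ->
    mean_curvature (local_expr c) (chart_map c p) =
    - normal_proj (local_expr c) (chart_map c p) (x p).

Definition kahler_angle (theta : M -> R) : Prop :=
  (forall p, 0 <= theta p <= pi) /\
  forall c p, surface_atlas c -> chart_dom c p -> forall a b,
    pullback_kahler_form (local_expr c) (chart_map c p) a b =
    cos (theta p) * volume_form (local_expr c) (chart_map c p) a b.

End Immersions.

(* Main.v *)
Require Import Defs.
From mathcomp Require Import all_boot all_order all_algebra.
From mathcomp Require Import all_classical all_reals all_analysis.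
From mathcomp Require Import ring lra.

(** Why no such sphere exists.

    Let X be the immersion read in an oriented chart, X_0 and X_1 its partial
    derivatives, g the induced metric, E = det g, kappa = <J X_0, X_1>, and let
    D be the complex determinant of X_0 and X_1.  Then |D|^2 = E - kappa^2
    ([norm_det]), so a constant Kaehler angle theta with sin theta <> 0 means that
    |D| is sin theta times the area element.  Hence D does not vanish, and its
    phase D / |D|, which does not depend on the oriented chart ([chart_phase_eq]),
    is a continuous map from M to the circle.  Geometrically, the self-dual part
    of the Gauss map stays on the parallel given by theta, and the phase is its
    longitude.  As M is a sphere, the phase lifts to a continuous angle
    alpha : M -> R ([sphere_phase_lift]).

    Constancy of theta makes the trilinear form <h(u, v), (J w)^perp> symmetric,
    where h is the second fundamental form.  Taking a trace gives
    sin^2 theta d(alpha)(v) = <H, J v>, and the equation H = - X^perp turns the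
    right-hand side into an expression in X and its first derivatives
    ([det_grad]).  Differentiating once more, with the shrinker equation again,
    shows that alpha is harmonic for the drift Laplacian
    Laplace - <X, grad> ([grad_n]).  By the strong maximum principle
    ([strong_maximum]) the set where alpha attains its maximum is open
    ([lifted_phase_locally_constant]); it is closed and M is connected, so alpha
    is constant.

    Thus <X^perp, J v> = 0 for every tangent vector v.  At a point where |X| is
    maximal, X is normal as well, so it is orthogonal to X_0, X_1, J X_0 and
    J X_1.  These vectors span the whole space because D <> 0, hence X = 0 at that
    point ([center_at_max]) and, by maximality, everywhere.  This contradicts that
    X is an immersion.

    Only X and its derivatives up to order two are used.  The local computations
    deal with scalar functions on the plane of known gradient ([grad_at]), and
    their outcome is reduced to polynomial identities between inner products. *)

Set Implicit Arguments.
Unset Strict Implicit.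
Unset Printing Implicit Defensive.
Import Order.TTheory GRing.Theory Num.Theory.
Import numFieldNormedType.Exports.

Local Open Scope classical_set_scope.
Local Open Scope ring_scope.

(** * Gradients of functions on the plane *)

Notation e0 := (delta_mx 0 0 : 'rV_2).
Notation e1 := (delta_mx 0 1 : 'rV_2).

(** Differentiability is part of the notion so that the two partial derivatives
    determine all directional ones and imply continuity. *)
Definition grad_at (R : realType) (f : 'rV[R]_2 -> R) (q : 'rV[R]_2)
    (g0 g1 : R) : Prop :=
  [/\ differentiable f q, 'D_e0 f q = g0 & 'D_e1 f q = g1].

Section Gradients.
Variable R : realType.
Implicit Types (f : 'rV[R]_2 -> R) (q v : 'rV[R]_2).

Lemma ord2E (i : 'I_2) : i = 0 \/ i = 1.
Proof. by case: i => [[|[|//]]] ?; [left|right]; apply/val_inj. Qed.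

Lemma rV2E v : v = v 0 0 *: e0 + v 0 1 *: e1.
Proof.
apply/rowP => i; rewrite !mxE /=.
by case: (ord2E i) => ->; rewrite /= ?mulr1 ?mulr0 ?addr0 ?add0r.
Qed.

Lemma grad_at_is_derive f q g0 g1 v : grad_at f q g0 g1 ->
  is_derive q v f (v 0 0 * g0 + v 0 1 * g1).
Proof.
move=> [df <- <-]; apply: DeriveDef; first exact: diff_derivable.
rewrite !deriveE // {1}(rV2E v) linearD !linearZ /=; congr (_ + _).
Qed.

Lemma grad_at_continuous f q g0 g1 : grad_at f q g0 g1 -> {for q, continuous f}.
Proof. by case=> df _ _; apply: differentiable_continuous. Qed.

Lemma grad_at_eq f q g0 g1 h0 h1 : grad_at f q g0 g1 -> g0 = h0 -> g1 = h1 ->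
  grad_at f q h0 h1.
Proof. by move=> ? <- <-. Qed.

Lemma grad_atC (c : R) q : grad_at (fun=> c) q 0 0.
Proof.
by split; [exact: (differentiable_cst c q)|exact: derive_cst..].
Qed.

Lemma grad_atD f (g : 'rV[R]_2 -> R) q a0 a1 b0 b1 :
  grad_at f q a0 a1 -> grad_at g q b0 b1 ->
  grad_at (fun p => f p + g p) q (a0 + b0) (a1 + b1).
Proof.
move=> [df <- <-] [dg <- <-]; split; first exact: differentiableD.
  by apply: deriveD; apply: diff_derivable.
by apply: deriveD; apply: diff_derivable.
Qed.

Lemma grad_atN f q a0 a1 : grad_at f q a0 a1 ->
  grad_at (fun p => - f p) q (- a0) (- a1).
Proof.
move=> [df <- <-]; split; first exact: differentiableN.
  by apply: deriveN; apply: diff_derivable.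
by apply: deriveN; apply: diff_derivable.
Qed.

Lemma grad_atM f (g : 'rV[R]_2 -> R) q a0 a1 b0 b1 :
  grad_at f q a0 a1 -> grad_at g q b0 b1 ->
  grad_at (fun p => f p * g p) q (f q * b0 + g q * a0) (f q * b1 + g q * a1).
Proof.
move=> [df <- <-] [dg <- <-]; split; first exact: differentiableM.
  by apply: deriveM; apply: diff_derivable.
by apply: deriveM; apply: diff_derivable.
Qed.

Lemma grad_atV f q a0 a1 : f q != 0 -> grad_at f q a0 a1 ->
  grad_at (fun p => (f p)^-1) q (- (f q) ^- 2 * a0) (- (f q) ^- 2 * a1).
Proof.
move=> f0 [df <- <-]; split; first exact: differentiableV.
  by apply: deriveV => //; apply: diff_derivable.
by apply: deriveV => //; apply: diff_derivable.
Qed.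

Lemma grad_at_coord (i : 'I_2) q :
  grad_at (fun p => p 0 i) q (i == 0)%:R (i == 1)%:R.
Proof.
have D v : 'D_v (fun p : 'rV[R]_2 => p 0 i) q = v 0 i.
  have := derive_mx (@derivable_id _ _ q v).
  by rewrite derive_id => /(congr1 (fun m : 'rV[R]_2 => m 0 i)); rewrite mxE.
split; first exact: differentiable_coord.
  by rewrite D mxE eqxx /= eq_sym.
by rewrite D mxE eqxx /= eq_sym.
Qed.

Lemma grad_at_expR f q a0 a1 : grad_at f q a0 a1 ->
  grad_at (fun p => expR (f p)) q (expR (f q) * a0) (expR (f q) * a1).
Proof.
move=> [df <- <-].
have de : differentiable (@expR R) (f q).
  by apply/derivable1_diffP; exact: derivable_expR.
have D v : 'D_v (fun p => expR (f p)) q = expR (f q) * 'D_v f q.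
  rewrite deriveE; last exact: (differentiable_comp df de).
  by rewrite (diff_comp df de) /= deriveE // diff1E // derive1E derive_val [LHS]mulrC.
by split; rewrite ?D //; exact: (differentiable_comp df de).
Qed.

End Gradients.

Section PointwiseContinuity.
Variables (R : realType) (T : topologicalType).
Implicit Types (f : T -> R) (q : T).

Lemma cont_atC (c : R) q : {for q, continuous (fun=> c : R)}.
Proof. exact: (@cst_continuous _ _ c q). Qed.

Lemma cont_atD f (g : T -> R) q : {for q, continuous f} ->
  {for q, continuous g} -> {for q, continuous (fun p => f p + g p)}.
Proof. by move=> cf cg; exact: cvgD cf cg. Qed.

Lemma cont_atN f q : {for q, continuous f} ->
  {for q, continuous (fun p => - f p)}.
Proof. by move=> cf; exact: cvgN cf. Qed.

Lemma cont_atM f (g : T -> R) q : {for q, continuous f} ->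
  {for q, continuous g} -> {for q, continuous (fun p => f p * g p)}.
Proof. by move=> cf cg; exact: cvgM cf cg. Qed.

Lemma cont_atV f q : f q != 0 -> {for q, continuous f} ->
  {for q, continuous (fun p => (f p)^-1)}.
Proof. by move=> f0 cf; exact: cvgV f0 cf. Qed.

End PointwiseContinuity.

(** * Symmetry of mixed derivatives, and the second derivative test *)

Section SecondOrder.
Variable R : realType.
Implicit Types (q p v w : 'rV[R]_2).

Lemma rV2_norm_lt v (d : R) : (`|v| < d) = (`|v 0 0| < d) && (`|v 0 1| < d).
Proof.
rewrite [X in X < _]/Num.Def.normr /= mx_normrE.
apply/bigmax_ltP/andP => /= [[d0 h]|[h0 h1]].
  by split; [exact: (h (0, 0))|exact: (h (0, 1))].
split=> [|[i j] _ /=]; first exact: le_lt_trans h0.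
by rewrite ord1; case: (ord2E j) => ->.
Qed.

Lemma is_derive_line (f : 'rV[R]_2 -> R) q v (t df : R) :
  is_derive (q + t *: v) v f df -> is_derive t 1 (fun s : R => f (q + s *: v)) df.
Proof.
have E : (fun h : R => h^-1 *: (((fun s => f (q + s *: v)) \o shift t) (h *: 1)
      - f (q + t *: v))) =
    (fun h : R => h^-1 *: ((f \o shift (q + t *: v)) (h *: v) - f (q + t *: v))).
  apply/funext => h /=; congr (_ *: (f _ - _)).
  by rewrite [h *: 1]mulr1 scalerDl addrCA.
by move=> [h1 h2]; split; rewrite /derivable /derive E.
Qed.

Lemma is_derive_continuous_line (f df : R -> R) (a b : R) :
  (forall s, a <= s <= b -> is_derive s 1 f (df s)) ->
  {within `[a, b], continuous f}.
Proof.
move=> h; apply: derivable_within_continuous => s; rewrite in_itv /= => /h hs.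
exact: ex_derive.
Qed.

(** The mean value theorem, used along [u] and then along [v].  The left-hand
    side is symmetric in [u] and [v], hence the symmetry of mixed derivatives
    below. *)
Lemma second_difference (f fu fuv : 'rV[R]_2 -> R) q u v (t : R) : 0 < t ->
  (forall s r, 0 <= s <= t -> 0 <= r <= t ->
    is_derive (q + r *: v + s *: u) u f (fu (q + r *: v + s *: u)) /\
    is_derive (q + s *: u + r *: v) v fu (fuv (q + s *: u + r *: v))) ->
  exists s r, [/\ 0 <= s <= t, 0 <= r <= t &
    f (q + t *: v + t *: u) - f (q + t *: u) - f (q + t *: v) + f q =
    t ^+ 2 * fuv (q + s *: u + r *: v)].
Proof.
move=> t0 h.
pose phi (s : R) := f (q + t *: v + s *: u) - f (q + s *: u).
have tt : 0 <= t <= t by rewrite lexx ltW.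
have z0 : (0 : R) <= 0 <= t by apply/andP; split; [exact: lexx|exact: ltW].
have dphi s : 0 <= s <= t ->
    is_derive s 1 phi (fu (q + t *: v + s *: u) - fu (q + s *: u)).
  move=> sb; apply: is_deriveB; apply: is_derive_line; first by have [] := h s t sb tt.
  by have [] := h s 0 sb z0; rewrite scale0r addr0.
have oc (s : R) : s \in `]0, t[%R -> 0 <= s <= t.
  by rewrite in_itv /= => /andP[/ltW -> /ltW ->].
have [s /oc sb Es] := MVT t0 (fun s hs => dphi s (oc s hs))
  (is_derive_continuous_line dphi).
have dpsi r : 0 <= r <= t ->
    is_derive r 1 (fun r : R => fu (q + s *: u + r *: v)) (fuv (q + s *: u + r *: v)).
  by move=> rb; apply: is_derive_line; have [] := h s r sb rb.
have [r /oc rb Er] := MVT t0 (fun s hs => dpsi s (oc s hs))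
  (is_derive_continuous_line dpsi).
exists s, r; split => //.
move: Es Er; rewrite /phi !scale0r !addr0 !subr0 => Es.
rewrite [q + s *: u + t *: v]addrAC => Er; move: Es; rewrite {}Er => Es.
have -> : t ^+ 2 * fuv (q + s *: u + r *: v) = fuv (q + s *: u + r *: v) * t * t by ring.
by rewrite -Es; ring.
Qed.

(** One second difference over a square of side [t] is [t ^+ 2] times either
    mixed derivative, each at some point of the square; let the square shrink. *)
Lemma mixed_derivatives_eq (U : set 'rV[R]_2) (f f0 f1 f00 f01 f10 f11 : 'rV[R]_2 -> R) q :
  open U -> U q ->
  (forall p, U p -> grad_at f p (f0 p) (f1 p)) ->
  (forall p, U p -> grad_at f0 p (f00 p) (f01 p)) ->
  (forall p, U p -> grad_at f1 p (f10 p) (f11 p)) ->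
  {for q, continuous f01} -> {for q, continuous f10} ->
  f01 q = f10 q.
Proof.
move=> oU Uq df df0 df1 c01 c10.
apply/eqP; rewrite -subr_eq0 -normr_le0; apply/ler_addgt0Pl => e e_gt0.
rewrite addr0.
have e2 : 0 < e / 2 by rewrite divr_gt0.
have : \forall p \near q, [/\ U p, `|f01 q - f01 p| < e / 2 & `|f10 q - f10 p| < e / 2].
  near=> p; split; first by near: p; exact: open_nbhs_nbhs.
    by near: p; apply: cvgr_dist_lt c01 _ e2.
  by near: p; apply: cvgr_dist_lt c10 _ e2.
move=> /nbhs_ballP[d /= d0 hd].
have d2 : 0 < d / 2 by rewrite divr_gt0.
have dd : d / 2 < d by rewrite ltr_pdivrMr // ltr_pMr // ltr1n.
have near_pt s r : 0 <= s <= d / 2 -> 0 <= r <= d / 2 ->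
    [/\ U (q + s *: e0 + r *: e1), `|f01 q - f01 (q + s *: e0 + r *: e1)| < e / 2 &
        `|f10 q - f10 (q + s *: e0 + r *: e1)| < e / 2].
  move=> /andP[s0 s1] /andP[r0 r1]; apply: hd; rewrite -ball_normE /=.
  rewrite -addrA opprD addNKr normrN rV2_norm_lt !mxE /= !mulr1 !mulr0 addr0 add0r.
  by rewrite !ger0_norm // (le_lt_trans s1 dd) (le_lt_trans r1 dd).
have sw s r : q + r *: e1 + s *: e0 = q + s *: e0 + r *: e1 by rewrite addrAC.
have c00 : (e0 : 'rV[R]_2) 0 0 = 1 by rewrite mxE.
have c0_1 : (e0 : 'rV[R]_2) 0 1 = 0 by rewrite mxE.
have c1_0 : (e1 : 'rV[R]_2) 0 0 = 0 by rewrite mxE.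
have c11 : (e1 : 'rV[R]_2) 0 1 = 1 by rewrite mxE.
have D0 (g : 'rV[R]_2 -> R) p a b : grad_at g p a b -> is_derive p e0 g a.
  by move=> /(grad_at_is_derive e0); rewrite c00 c0_1 mul1r mul0r addr0.
have D1 (g : 'rV[R]_2 -> R) p a b : grad_at g p a b -> is_derive p e1 g b.
  by move=> /(grad_at_is_derive e1); rewrite c1_0 c11 mul1r mul0r add0r.
have [s [r [sb rb E1]]] := @second_difference f f0 f01 q e0 e1 _ d2 (fun s r sb rb =>
  let: And3 Up _ _ := near_pt s r sb rb in
  conj (eq_ind_r (fun x => is_derive x e0 f (f0 x)) (D0 _ _ _ _ (df _ Up)) (sw s r))
     (D1 _ _ _ _ (df0 _ Up))).
have [r' [s' [rb' sb' E2]]] := @second_difference f f1 f10 q e1 e0 _ d2 (fun r s rb sb =>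
  let: And3 Up _ _ := near_pt s r sb rb in
  conj (D1 _ _ _ _ (df _ Up))
   (eq_ind_r (fun x => is_derive x e0 f1 (f10 x)) (D0 _ _ _ _ (df1 _ Up)) (sw s r))).
have E : f01 (q + s *: e0 + r *: e1) = f10 (q + s' *: e0 + r' *: e1).
  have d22 : (d / 2) ^+ 2 != 0 by rewrite expf_neq0 // gt_eqF.
  apply: (mulfI d22); rewrite -E1 -sw -E2.
  by rewrite [q + d / 2 *: e0 + _]addrAC; ring.
have [_ h1 _] := near_pt s r sb rb; have [_ _ h2] := near_pt s' r' sb' rb'.
have -> : f01 q - f10 q = (f01 q - f01 (q + s *: e0 + r *: e1)) -
  (f10 q - f10 (q + s' *: e0 + r' *: e1)) by rewrite E; ring.
rewrite (le_trans (ler_normB _ _)) // ltW //.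
by rewrite [e]splitr ltrD.
Unshelve. all: by end_near. Qed.

(** The test of one variable along the line through [q] directed by [v]: a
    positive second derivative would make [f] increase along this line. *)
Lemma second_derivative_max (f f0 f1 : 'rV[R]_2 -> R) q v f00 f01 f10 f11 :
  (\forall p \near q, grad_at f p (f0 p) (f1 p)) ->
  grad_at f0 q f00 f01 -> grad_at f1 q f10 f11 ->
  (\forall p \near q, f p <= f q) ->
  v 0 0 * f0 q + v 0 1 * f1 q = 0 /\
  v 0 0 * (v 0 0 * f00 + v 0 1 * f01) + v 0 1 * (v 0 0 * f10 + v 0 1 * f11) <= 0.
Proof.
move=> df df0 df1 fmax.
pose phi (t : R) := f (q + t *: v).
pose psi (t : R) := v 0 0 * f0 (q + t *: v) + v 0 1 * f1 (q + t *: v).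
have line : (fun t : R => q + t *: v) @ (0 : R) --> q.
  rewrite -[X in _ --> X]addr0 -[in X in _ --> X](scale0r v).
  by apply: cvgD; [exact: cvg_cst|apply: cvgZr_tmp; exact: cvg_id].
have : nbhs (0 : R) (fun t : R => is_derive t 1 phi (psi t) /\ phi t <= phi 0).
  have L1 : nbhs (0 : R) (fun t : R =>
      grad_at f (q + t *: v) (f0 (q + t *: v)) (f1 (q + t *: v))) := line _ df.
  have L2 : nbhs (0 : R) (fun t : R => f (q + t *: v) <= f q) := line _ fmax.
  move: L1 L2; apply: filterS2 => t dt mt; split.
    by apply: is_derive_line; exact: grad_at_is_derive.
  by rewrite /phi scale0r addr0.
move=> /nbhs_ballP[d /= d0 hd].
have hb t : t \in `]- d, d[%R -> is_derive t 1 phi (psi t) /\ phi t <= phi 0.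
  by rewrite in_itv /= => tb; apply: hd; rewrite -ball_normE /= sub0r normrN ltr_norml.
have zb : (0 : R) \in `]- d, d[%R by rewrite in_itv /= oppr_lt0 d0.
have psi0 : psi 0 = 0.
  have [h1 _] := hb 0 zb; have [_ <-] := h1.
  have h2 := derive1_at_max _ (fun t ht => @ex_derive _ _ _ _ _ _ _ (hb t ht).1) zb
     (fun t ht => (hb t ht).2).
  by have [_ ->] := h2 (ltW (lt_trans (etrans (oppr_lt0 d) d0) d0)).
split; first by move: psi0; rewrite /psi scale0r addr0.
set D := (X in X <= 0); rewrite leNgt; apply/negP => D0.
have dpsi : is_derive (0 : R) 1 psi D.
  have h0 : is_derive (0 : R) 1 (fun t : R => f0 (q + t *: v)) (v 0 0 * f00 + v 0 1 * f01).
    by apply: is_derive_line; rewrite scale0r addr0; exact: grad_at_is_derive.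
  have h1 : is_derive (0 : R) 1 (fun t : R => f1 (q + t *: v)) (v 0 0 * f10 + v 0 1 * f11).
    by apply: is_derive_line; rewrite scale0r addr0; exact: grad_at_is_derive.
  exact: (is_deriveD (is_deriveZ (v 0 0) h0) (is_deriveZ (v 0 1) h1)).
have [r r0 psipos] : exists2 r, 0 < r & forall t, 0 < t < r -> 0 < psi t.
  have [c E] := dpsi; move: c; rewrite /derivable => /cvg_ex[l hl].
  have lD : l = D by rewrite -E; apply/esym/cvg_lim.
  rewrite {}lD in hl.
  have : nbhs (0 : R) (fun h : R => h != 0 ->
      0 < h^-1 *: ((psi \o shift 0) (h *: 1) - psi 0)) := cvgr_gt D hl _ D0.
  move=> /(_ _) /nbhs_ballP[r /= r0 hr].
  exists r => // t /andP[t0 tr].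
  have := hr t; rewrite -ball_normE /= sub0r normrN gtr0_norm // => /(_ tr).
  rewrite gt_eqF // => /(_ isT); rewrite psi0 addr0 subr0 [t *: 1]mulr1.
  by rewrite [_ *: _]/(_ * _) pmulr_rgt0 // invr_gt0.
pose t := Num.min r d / 2.
have m0 : 0 < Num.min r d by rewrite lt_min r0.
have t0 : 0 < t by rewrite divr_gt0.
have tm : t < Num.min r d by rewrite ltr_pdivrMr // ltr_pMr // ltr1n.
have /andP[tr td] : (t < r) && (t < d) by rewrite -lt_min.
have bd s : 0 <= s <= t -> s \in `]- d, d[%R.
  move=> /andP[s0 st]; rewrite in_itv /= (le_lt_trans st td) andbT.
  by rewrite (lt_le_trans _ s0) // oppr_lt0.
have oc (s : R) : s \in `]0, t[%R -> 0 <= s <= t.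
  by rewrite in_itv /= => /andP[/ltW -> /ltW ->].
have [c + Ec] := MVT t0 (fun s hs => (hb s (bd s (oc s hs))).1)
  (is_derive_continuous_line (fun s hs => (hb s (bd s hs)).1)).
rewrite in_itv /= => /andP[c0 ct].
have : phi t <= phi 0 by apply: (hb _ _).2; apply: bd; rewrite lexx ltW.
rewrite leNgt => /negP; apply; rewrite -subr_gt0 Ec subr0 mulr_gt0 //.
by apply: psipos; rewrite c0 (lt_trans ct tr).
Qed.

End SecondOrder.

(** * The strong maximum principle *)

(** Computes the gradient of an expression by the rules of calculus; the leaves
    are discharged by assumption. *)
Ltac grad_rules :=
  repeat first
    [ eassumption
    | eapply grad_atC
    | eapply grad_at_coord
    | eapply grad_atD
    | eapply grad_atN
    | eapply grad_atM
    | eapply grad_at_expR ].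

Ltac grad_compute := eapply grad_at_eq; [ solve [grad_rules] | | ].

Section StrongMaximumPrinciple.
Variable R : realType.
Implicit Types (p q : 'rV[R]_2).

Lemma norm_sub_continuous p : continuous (fun q : 'rV[R]_2 => `|q - p|).
Proof.
move=> q; have h : (fun x : 'rV[R]_2 => x - p) @ q --> q - p.
  by apply: (@cvgB _ 'rV[R]_2 _ (nbhs q) _ id (cst p)); [exact: cvg_id|exact: cvg_cst].
exact: cvg_norm h.
Qed.

(** The norm is the supremum norm, so this annulus is a difference of squares. *)
Lemma compact_annulus p (r d : R) : compact [set q | r <= `|q - p| <= d].
Proof.
apply: bounded_closed_compact.
  exists (`|p| + d); split; first exact: num_real.
  move=> x /ltW xd q /= /andP[_ qd]; apply: le_trans xd.
  have := ler_normD p (q - p); have -> : p + (q - p) = q by rewrite addrC subrK.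
  by move=> /le_trans; apply; rewrite lerD2l.
rewrite (_ : [set _ | _] = (fun q : 'rV[R]_2 => `|q - p|) @^-1` `[r, d]); last first.
  by apply/seteqP; split=> q; rewrite /= in_itv.
apply: preimage_closed; last exact: interval_closed.
by move=> q _; exact: norm_sub_continuous.
Qed.

(** The Hopf barrier exp (- k |q - p|^2): in its second derivatives the terms
    in [k ^+ 2] form a positive semidefinite matrix, and they dominate for large
    [k] away from [p]. *)
Lemma gauss_barrier p (k : R) q :
  let w q := expR (- k * ((q 0 0 - p 0 0) * (q 0 0 - p 0 0) +
                          (q 0 1 - p 0 1) * (q 0 1 - p 0 1))) in
  let w0 q := - k * 2 * (q 0 0 - p 0 0) * w q in
  let w1 q := - k * 2 * (q 0 1 - p 0 1) * w q in
  [/\ grad_at w q (w0 q) (w1 q),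
      grad_at w0 q ((4 * k * k * (q 0 0 - p 0 0) ^+ 2 - 2 * k) * w q)
        (4 * k * k * (q 0 0 - p 0 0) * (q 0 1 - p 0 1) * w q) &
      grad_at w1 q (4 * k * k * (q 0 0 - p 0 0) * (q 0 1 - p 0 1) * w q)
        ((4 * k * k * (q 0 1 - p 0 1) ^+ 2 - 2 * k) * w q)].
Proof.
move=> w w0 w1.
have dw : grad_at w q (w0 q) (w1 q).
  by grad_compute; rewrite /= /w0 /w1 /w; ring.
by split => //; grad_compute; rewrite /= /w0 /w1 /=; ring.
Qed.

Lemma rV2_sqr_ge (v : 'rV[R]_2) (r : R) : 0 <= r -> r <= `|v| ->
  r ^+ 2 <= v 0 0 * v 0 0 + v 0 1 * v 0 1.
Proof.
move=> r0 rv; rewrite leNgt; apply/negP => h.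
suff : `|v| < r by rewrite ltNge rv.
have key (a : R) : a * a < r ^+ 2 -> `|a| < r.
  by move=> ha; rewrite -(ger0_norm r0) -ltr_sqr ?nnegrE // !real_normK ?num_real // expr2.
have s0 := sqr_ge0 (v 0 0); have s1 := sqr_ge0 (v 0 1); rewrite !expr2 in h s0 s1.
by rewrite rV2_norm_lt; apply/andP; split; apply: key; rewrite expr2; lra.
Qed.

Lemma rV2_sqr_lt (v : 'rV[R]_2) (r : R) : `|v| < r ->
  v 0 0 * v 0 0 + v 0 1 * v 0 1 < 2 * r ^+ 2.
Proof.
move=> vr; have r0 : 0 <= r by rewrite ltW // (le_lt_trans _ vr).
have key (a : R) : `|a| < r -> a * a < r ^+ 2.
  by rewrite -{1}(ger0_norm r0) -ltr_sqr ?nnegrE // !real_normK ?num_real // expr2.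
by move: vr; rewrite rV2_norm_lt => /andP[/key h0 /key h1]; lra.
Qed.

(** Suppose [u p < u q0] for a point [p] much closer to [q0] than to the
    complement of [U].  For large [k] the elliptic operator is positive on the
    barrier centred at [p], outside a small square around [p].  Add a small
    multiple of the barrier to [u] on an annulus around [p] which contains [q0].
    On the inner boundary [u] is too small, and on the outer boundary the barrier
    is smaller than at [q0]; so the maximum of the sum is attained inside, where
    the operator is positive although the Hessian is nonpositive: a
    contradiction. *)
Lemma strong_maximum (U : set 'rV[R]_2)
    (u u0 u1 u00 u01 u10 u11 a00 a01 a11 b0 b1 : 'rV[R]_2 -> R) q0 :
  open U -> U q0 ->
  (forall p, U p -> grad_at u p (u0 p) (u1 p)) ->
  (forall p, U p -> grad_at u0 p (u00 p) (u01 p)) ->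
  (forall p, U p -> grad_at u1 p (u10 p) (u11 p)) ->
  (forall p, U p -> [/\ {for p, continuous a00}, {for p, continuous a01},
     {for p, continuous a11}, {for p, continuous b0} & {for p, continuous b1}]) ->
  (forall p, U p -> 0 < a00 p /\ 0 < a00 p * a11 p - a01 p ^+ 2) ->
  (forall p, U p -> a00 p * u00 p + a01 p * (u01 p + u10 p) + a11 p * u11 p
      + b0 p * u0 p + b1 p * u1 p = 0) ->
  (forall p, U p -> u p <= u q0) ->
  \forall p \near q0, u p = u q0.
Proof.
move=> oU Uq du du0 du1 cab pos Lu umax.
have /nbhs_ballP[D /= D0 hD] := open_nbhs_nbhs (conj oU Uq).
apply/nbhs_ballP; exists (D / 4) => /=; first by rewrite divr_gt0.
move=> p; rewrite -ball_normE /= => pq; apply/eqP; apply/negPn/negP => up_neq.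
have Up : U p.
  by apply: hD; rewrite -ball_normE /=; apply: lt_le_trans pq _; lra.
have up : u p < u q0 by rewrite lt_neqAle up_neq umax.
pose m := (u p + u q0) / 2.
have [um mu] : u p < m /\ m < u q0 by rewrite /m; split; lra.
have [r [r0 hr]] : exists r, 0 < r /\ forall q, `|q - p| <= r -> u q < m.
  have cu := grad_at_continuous (du _ Up).
  have /(_ _)/nbhs_ballP[r /= r0 hr] := cvgr_lt _ cu _ um.
  exists (r / 2); split; first by rewrite divr_gt0.
  move=> q qp; apply: hr; rewrite -ball_normE /= distrC (le_lt_trans qp) //; lra.
have q0p : `|q0 - p| < D / 4 by [].
pose K := [set q | r <= `|q - p| <= D / 2].
have KU q : K q -> U q.
  move=> /andP[_ qp]; apply: hD; rewrite -ball_normE /=.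
  have := ler_normB (q0 - p) (q - p).
  have -> : q0 - p - (q - p) = q0 - q by rewrite opprB addrA subrK.
  by move=> /le_lt_trans; apply; lra.
have cK : compact K := @compact_annulus p r (D / 2).
have Kq0 : K q0.
  rewrite /K /= (ltW (lt_trans q0p _)) ?andbT; last by lra.
  by rewrite leNgt; apply/negP => /ltW /hr; rewrite ltNge ltW.
pose x (q : 'rV[R]_2) := q 0 0 - p 0 0; pose y (q : 'rV[R]_2) := q 0 1 - p 0 1.
have cx q : {for q, continuous x}.
  exact: grad_at_continuous (grad_atD (grad_at_coord 0 q) (grad_atC _ q)).
have cy q : {for q, continuous y}.
  exact: grad_at_continuous (grad_atD (grad_at_coord 1 q) (grad_atC _ q)).
have xE q : x q = (q - p) 0 0 by rewrite !mxE.
have yE q : y q = (q - p) 0 1 by rewrite !mxE.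
have Kxy q : K q -> 0 < x q * x q + y q * y q.
  move=> /andP[rq _]; rewrite !xE !yE; apply: lt_le_trans (rV2_sqr_ge (ltW r0) rq).
  by rewrite exprn_gt0.
(* On the barrier of parameter k, the operator is multiplication by
   2 k (2 k Q - T). *)
pose Q q := a00 q * (x q * x q) + a01 q * (x q * y q) + a01 q * (x q * y q)
  + a11 q * (y q * y q).
pose T q := a00 q + a11 q + b0 q * x q + b1 q * y q.
have Qpos q : K q -> 0 < Q q.
  move=> Kq; have [a0 dt] := pos _ (KU _ Kq); rewrite -(pmulr_rgt0 _ a0).
  have -> : a00 q * Q q = (a00 q * x q + a01 q * y q) ^+ 2 +
     (a00 q * a11 q - a01 q ^+ 2) * y q ^+ 2 by rewrite /Q; ring.
  have [y0|y0] := eqVneq (y q) 0.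
    have := Kxy _ Kq; rewrite y0 => xx; rewrite !mulr0 !addr0 expr0n /= mulr0 addr0 expr2.
    have : x q != 0 by apply: contraTneq xx => ->; rewrite !mulr0 addr0 ltxx.
    by move=> x0; rewrite -expr2 exprn_even_gt0 //= mulf_neq0 // gt_eqF.
  apply: ltr_wpDl; first exact: sqr_ge0.
  by rewrite mulr_gt0 // exprn_even_gt0.
have cQT q : K q -> {for q, continuous Q} /\ {for q, continuous T}.
  move=> /KU /cab[c1 c2 c3 c4 c5]; split.
    exact: (cont_atD (cont_atD (cont_atD (cont_atM c1 (cont_atM (cx q) (cx q)))
      (cont_atM c2 (cont_atM (cx q) (cy q)))) (cont_atM c2 (cont_atM (cx q) (cy q))))
      (cont_atM c3 (cont_atM (cy q) (cy q)))).
  exact: (cont_atD (cont_atD (cont_atD c1 c3) (cont_atM c4 (cx q))) (cont_atM c5 (cy q))).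
have Kwithin (f : 'rV[R]_2 -> R) : (forall q, K q -> {for q, continuous f}) ->
    {within K, continuous f}.
  by move=> h; apply: continuous_in_subspaceT => q; rewrite inE => /h.
have [qm Kqm Qmin] := compact_EVT_min (ex_intro _ _ Kq0) cK
   (Kwithin _ (fun q Kq => (cQT q Kq).1)).
have [qM _ Tmax] := compact_EVT_max (ex_intro _ _ Kq0) cK
   (Kwithin _ (fun q Kq => (cQT q Kq).2)).
have lam0 : 0 < Q qm by apply: Qpos; rewrite inE in Kqm.
pose k := (`|T qM| + 1) / Q qm.
have k0 : 0 < k by rewrite divr_gt0 // ltr_wpDl.
have kQT q : K q -> 0 < 2 * k * Q q - T q.
  move=> Kq; have qK : q \in K by rewrite inE.
  have h1 := Qmin _ qK; have h2 := Tmax _ qK.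
  have h3 : k * Q qm = `|T qM| + 1 by rewrite /k divfK ?gt_eqF.
  have h4 := ler_norm (T qM); have h5 := normr_ge0 (T qM).
  have h6 : k * Q qm <= k * Q q by rewrite ler_pM2l.
  by lra.
pose w (q : 'rV[R]_2) := expR (- k * (x q * x q + y q * y q)).
pose w0 q := - k * 2 * x q * w q; pose w1 q := - k * 2 * y q * w q.
pose eps := (u q0 - m) / 2.
have eps_gt0 : 0 < eps by rewrite /eps; lra.
pose z q := u q + eps * w q.
have dz q : U q -> grad_at z q (u0 q + eps * w0 q) (u1 q + eps * w1 q).
  move=> /du ?; have [? _ _] := gauss_barrier p k q.
  by grad_compute; rewrite mulr0 addr0.
have w_gt0 q : 0 < w q by exact: expR_gt0.
have w_le1 q : w q <= 1.
  rewrite -expR0 ler_expR mulNr oppr_le0 mulr_ge0 ?(ltW k0) //.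
  by rewrite addr_ge0 // -expr2 sqr_ge0.
have [qs] := compact_EVT_max (ex_intro _ _ Kq0) cK
   (Kwithin _ (fun q Kq => grad_at_continuous (dz q (KU q Kq)))).
rewrite inE => Kqs zmax; have Us := KU _ Kqs.
have zq0 : u q0 + eps * w q0 <= z qs by apply: zmax; rewrite inE.
have eq0 : 0 < eps * w q0 by rewrite mulr_gt0.
have ew : eps * w qs <= eps by rewrite ger_pMr.
have rs : r < `|qs - p|.
  rewrite ltNge; apply/negP => /hr uqs.
  by move: zq0; rewrite leNgt => /negP; apply; rewrite /z /eps in ew eq0 *; lra.
have sD : `|qs - p| < D / 2.
  rewrite ltNge; apply/negP => Ds.
  have D2 : 0 <= D / 2 by lra.
  have h1 := rV2_sqr_ge D2 Ds; have h2 := rV2_sqr_lt q0p.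
  rewrite -!xE -!yE in h1 h2.
  have : w qs < w q0.
    rewrite ltr_expR !mulNr ltrN2 ltr_pM2l //; apply: lt_le_trans h2 _.
    apply: le_trans h1; rewrite !expr2; have := mulr_gt0 D0 D0; lra.
  move=> h3; move: zq0; rewrite /z leNgt => /negP; apply.
  by rewrite ler_ltD ?umax // ltr_pM2l.
have nearK : \forall q \near qs, K q.
  have cn : (fun q : 'rV[R]_2 => `|q - p|) q @[q --> qs] --> `|qs - p|.
    exact: norm_sub_continuous.
  near=> q; apply/andP; split; apply: ltW; near: q.
    exact: cvgr_gt cn _ rs.
  exact: cvgr_lt cn _ sD.
have ndz : \forall q \near qs, grad_at z q (u0 q + eps * w0 q) (u1 q + eps * w1 q).
  by near=> q; apply: dz; apply: KU; near: q.
have nmax : \forall q \near qs, z q <= z qs.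
  by near=> q; apply: zmax; rewrite inE; near: q.
have [_ dw0 dw1] := gauss_barrier p k qs.
have ddz0 := grad_atD (du0 _ Us) (grad_atM (grad_atC eps qs) dw0).
have ddz1 := grad_atD (du1 _ Us) (grad_atM (grad_atC eps qs) dw1).
(* Completing the square: [a00] times the second-order part is the second
   derivative along [v] plus the determinant times the one along [e1]. *)
pose v : 'rV[R]_2 := \row_i if i == 0 then a00 qs else a01 qs.
have [g1 h1] := second_derivative_max (delta_mx 0 1) ndz ddz0 ddz1 nmax.
have [gv hv] := second_derivative_max v ndz ddz0 ddz1 nmax.
rewrite !mxE /= -/(x qs) -/(y qs) -/(w qs) in g1 h1 gv hv.
have [a0 det0] := pos _ Us; have LU := Lu _ Us; have kqt := kQT _ Kqs.
have Lw : 0 < 2 * k * eps * w qs * (2 * k * Q qs - T qs).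
  do 3 (apply: mulr_gt0 => //); exact: mulr_gt0.
have z1 : u1 qs + eps * w1 qs = 0 by move: g1; rewrite mul0r mul1r add0r.
have z0 : u0 qs + eps * w0 qs = 0.
  by move: gv; rewrite z1 mulr0 addr0 => /eqP; rewrite mulf_eq0 gt_eqF //= => /eqP.
rewrite !mul0r !mul1r !add0r in h1.
set z11 := (X in X <= 0) in h1; have dz11 := mulr_ge0_le0 (ltW det0) h1.
have a0L := mulr_gt0 a0 Lw.
set zv := (X in X <= 0) in hv.
suff E : a00 qs * (2 * k * eps * w qs * (2 * k * Q qs - T qs)) =
    zv + (a00 qs * a11 qs - a01 qs ^+ 2) * z11.
  by move: a0L; rewrite E ltNge -[X in _ <= X]addr0 lerD.
transitivity (a00 qs * (2 * k * eps * w qs * (2 * k * Q qs - T qs)) +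
    a00 qs * (a00 qs * u00 qs + a01 qs * (u01 qs + u10 qs) + a11 qs * u11 qs
       + b0 qs * u0 qs + b1 qs * u1 qs)
    - a00 qs * b0 qs * (u0 qs + eps * w0 qs) - a00 qs * b1 qs * (u1 qs + eps * w1 qs)).
  by rewrite LU z0 z1 !mulr0 !subr0 addr0.
by rewrite /zv /z11 /Q /T /w0 /w1; ring.
Unshelve. all: by end_near. Qed.

End StrongMaximumPrinciple.

(** * Lifting phases on the sphere *)

Section PhaseLifting.
Variable R : realType.
Implicit Types (z v : 'rV[R]_2).

Lemma phase_eq (a b : R) : cos a = cos b -> sin a = sin b -> `|a - b| <= pi ->
  a = b.
Proof.
move=> ca sa ab; apply/eqP; rewrite -subr_eq0 -normr_eq0; apply/eqP.
apply: cos_inj; rewrite ?in_itv /= ?normr_ge0 ?lexx ?pi_ge0 //.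
by rewrite cos_norm cos0 cosB ca sa -!expr2 cos2Dsin2.
Qed.

Lemma phase_exists (c s : R) : c ^+ 2 + s ^+ 2 = 1 ->
  exists2 a, cos a = c & sin a = s.
Proof.
move=> cs; have c1 : -1 <= c <= 1.
  by rewrite -ler_norml -(@expr_le1 _ 2) // real_normK ?num_real // -cs lerDl sqr_ge0.
have s2 : Num.sqrt (1 - c ^+ 2) = `|s|.
  by rewrite -cs addrAC subrr add0r sqrtr_sqr.
have [s0|s0] := leP 0 s.
  exists (acos c); first by rewrite acosK // in_itv.
  by rewrite sin_acos // s2 ger0_norm.
exists (- acos c); first by rewrite cosN acosK // in_itv.
by rewrite sinN sin_acos // s2 ltr0_norm // opprK.
Qed.

(** Two values of [b] differ by a multiple of a full turn, and a continuous
    function on the line cannot jump. *)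
Lemma phase_constant (b : R -> R) (c s : R) : continuous b ->
  (forall t, cos (b t) = c) -> (forall t, sin (b t) = s) ->
  forall t t', b t = b t'.
Proof.
move=> cb bc bs.
suff le_b t t' : b t <= b t' -> b t = b t'.
  move=> t t'; have [/le_b //|/ltW /le_b //] := leP (b t) (b t').
move=> btt; apply/eqP; rewrite eq_le btt leNgt /=; apply/negP => lt_b.
pose h := Num.min (b t' - b t) 1.
have h0 : 0 < h by rewrite lt_min subr_gt0 lt_b ltr01.
have [r hr] : exists r, b r = b t + h.
  have bh : b t <= b t + h <= b t'.
    by rewrite lerDl ltW //= -lerBrDl ge_min lexx.
  have wlog_IVT (x y : R) : x <= y ->
      Num.min (b x) (b y) <= b t + h <= Num.max (b x) (b y) -> exists r, b r = b t + h.
    move=> xy hb; have cxy : {within `[x, y], continuous b} by exact: continuous_subspaceT.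
    by have [r _ E] := IVT xy cxy hb; exists r.
  have [tt|/ltW tt] := leP t t'.
    by apply: (wlog_IVT t t') => //; rewrite min_l // max_r.
  by apply: (wlog_IVT t' t) => //; rewrite min_r // max_l.
have : b r = b t.
  apply: phase_eq; rewrite ?bc ?bs //.
  rewrite hr addrAC subrr add0r gtr0_norm // (le_trans _ (pi_ge2 R)) //.
  by rewrite (@le_trans _ _ 1) ?ler1n // ge_min lexx orbT.
by rewrite hr => /eqP; rewrite addrC -subr_eq0 addrK gt_eqF.
Qed.

Lemma heine (h : 'rV[R]_2 -> R) (K : set 'rV[R]_2) (e : R) :
  continuous h -> compact K -> 0 < e ->
  exists2 d, 0 < d & forall x y, K x -> `|x - y| < d -> `|h x - h y| < e.
Proof.
move=> ch /compact_near_coveringP cK e_gt0.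
have := cK R (0 : R)^'+ (fun d x => forall y, `|x - y| < d -> `|h x - h y| < e) _.
have H x : K x -> \forall x' \near x & d \near (0 : R)^'+,
    forall y, `|x' - y| < d -> `|h x' - h y| < e.
  move=> Kx.
  have e2 : 0 < e / 2 by rewrite divr_gt0.
  have /(_ _) /nbhs_ballP[r /= r0 hr] := cvgr_dist_lt h (h x) (ch x) _ e2.
  have r2 : 0 < r / 2 by rewrite divr_gt0.
  exists (ball x (r / 2), [set d | d < r / 2]).
    by split; [exact: nbhsx_ballx|exact: nbhs_right_lt].
  move=> [x' d] /= [xx' dr] y xy.
  have h1 : `|h x - h x'| < e / 2.
    by apply: hr; apply: le_ball xx'; lra.
  have h2 : `|h x - h y| < e / 2.
    apply: hr; rewrite -ball_normE /= in xx' *.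
    have -> : x - y = (x - x') + (x' - y) by rewrite addrA subrK.
    by rewrite (le_lt_trans (ler_normD _ _)) //; lra.
  have -> : h x' - h y = (h x - h y) - (h x - h x') by ring.
  by rewrite (le_lt_trans (ler_normB _ _)) //; lra.
move=> /(_ _ H) Hd.
have : \forall d \near (0 : R)^'+, 0 < d /\
    K `<=` (fun x => forall y, `|x - y| < d -> `|h x - h y| < e).
  near=> d; split; first by near: d; exact: nbhs_right_gt.
  by near: d.
move=> /filter_ex[d [d0 hd]]; exists d => // x y Kx; exact: hd.
Unshelve. all: by end_near. Qed.

(** The arcsine of the cross product is the angle from [(c, s)] to [(c', s')]
    when these unit vectors are close, for their inner product is then
    positive. *)
Lemma small_rotation (c s c' s' : R) : c ^+ 2 + s ^+ 2 = 1 ->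
  c' ^+ 2 + s' ^+ 2 = 1 -> `|c - c'| < 1 / 2 -> `|s - s'| < 1 / 2 ->
  let w := s' * c - c' * s in
  [/\ -1 < w < 1, cos (asin w) = c' * c + s' * s & sin (asin w) = w].
Proof.
move=> cs cs' /ltr_normlP[c1 c2] /ltr_normlP[s1 s2] w.
have re : 0 < c' * c + s' * s.
  have h1 : 0 < (1 / 2 - (c - c')) * (1 / 2 + (c - c')) by apply: mulr_gt0; lra.
  have h2 : 0 < (1 / 2 - (s - s')) * (1 / 2 + (s - s')) by apply: mulr_gt0; lra.
  rewrite !expr2 in cs cs'; lra.
have sum1 : (c' * c + s' * s) ^+ 2 + w ^+ 2 = 1.
  transitivity ((c ^+ 2 + s ^+ 2) * (c' ^+ 2 + s' ^+ 2)); first by rewrite /w; ring.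
  by rewrite cs cs' mulr1.
have w1 : -1 < w < 1.
  rewrite -ltr_norml -(@expr_lt1 _ 2) // real_normK ?num_real // -sum1 ltrDr.
  by rewrite exprn_gt0.
have w1' : -1 <= w <= 1 by case/andP: w1 => /ltW -> /ltW ->.
split=> //; last by rewrite asinK // in_itv.
by rewrite cos_asin // -sum1 addrK sqrtr_sqr gtr0_norm.
Qed.

(** By uniform continuity on the disk, the phase turns by less than a quarter
    turn between consecutive points of a fine enough regular subdivision of any
    radius; the angle is the sum of these small rotations. *)
Lemma plane_phase_lift (c s : 'rV[R]_2 -> R) (r : R) : continuous c ->
  continuous s -> (forall z, c z ^+ 2 + s z ^+ 2 = 1) ->
  exists a : 'rV[R]_2 -> R, forall z, `|z| < r ->
    [/\ {for z, continuous a}, cos (a z) = c z & sin (a z) = s z].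
Proof.
move=> cc cs cs1.
have [r0|r0] := leP r 0.
  exists (fun=> 0) => z /lt_le_trans /(_ r0); by rewrite ltNge normr_ge0.
have cK : compact [set z : 'rV[R]_2 | 0 <= `|z - 0| <= r] := @compact_annulus R 0 0 r.
have h12 : 0 < (1 / 2 : R) by lra.
have [d1 d10 hd1] := heine cc cK h12.
have [d2 d20 hd2] := heine cs cK h12.
pose d := Num.min d1 d2.
have d0 : 0 < d by rewrite lt_min d10.
have [n hn] : exists n : nat, r / d < n.+1%:R.
  by exists (Num.truncn (r / d)); exact/real_truncnS_gt/num_real.
have n0 : 0 < n.+1%:R :> R by rewrite ltr0Sn.
pose pt k z : 'rV[R]_2 := (k%:R / n.+1%:R) *: z.
pose w k z := s (pt k.+1 z) * c (pt k z) - c (pt k.+1 z) * s (pt k z).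
have step k z : (k <= n.+1)%N -> `|z| < r ->
    [/\ -1 < w k z < 1,
     cos (asin (w k z)) = c (pt k.+1 z) * c (pt k z) + s (pt k.+1 z) * s (pt k z) &
     sin (asin (w k z)) = w k z].
  move=> kn zr.
  have K : [set z : 'rV[R]_2 | 0 <= `|z - 0| <= r] (pt k z).
    rewrite /= normr_ge0 /= subr0 normrZ (le_trans _ (ltW zr)) //.
    rewrite ler_piMl // ger0_norm ?divr_ge0 ?ler0n // ler_pdivrMr // mul1r.
    by rewrite ler_nat.
  have dist : `|pt k z - pt k.+1 z| < d.
    rewrite -scalerBl normrZ -mulrBl -natr1 opprD addNKr mulN1r normrN.
    rewrite gtr0_norm ?invr_gt0 // mulrC ltr_pdivrMr // mulrC -ltr_pdivrMr //.
    by apply: lt_trans hn; rewrite ltr_pM2r ?invr_gt0.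
  by move: dist; rewrite lt_min => /andP[/(hd1 _ _ K) ? /(hd2 _ _ K) ?]; exact: small_rotation.
have [a0 ca0 sa0] := phase_exists (cs1 0).
pose a k z := a0 + \sum_(i < k) asin (w i z).
exists (a n.+1) => z zr.
have cpt (f : 'rV[R]_2 -> R) k : continuous f -> {for z, continuous (fun z => f (pt k z))}.
  move=> cf; apply: continuous_comp; last exact: cf.
  exact: scaler_continuous.
have ind k : (k <= n.+1)%N -> [/\ {for z, continuous (a k)},
    cos (a k z) = c (pt k z) & sin (a k z) = s (pt k z)].
  elim: k => [_|k IH kn].
    rewrite /a /pt mul0r scale0r big_ord0 addr0; split=> //.
    rewrite (_ : (fun z => _) = cst a0); first exact: cst_continuous.
    by apply/funext => y; rewrite big_ord0 addr0.
  have [ck hc hs] := IH (ltnW kn); have [w1 cw sw] := step k z (ltnW kn) zr.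
  have aS y : a k.+1 y = a k y + asin (w k y) by rewrite /a big_ord_recr addrA.
  split.
  - rewrite (_ : a k.+1 = (fun y => a k y + asin (w k y))); last exact/funext.
    apply: cont_atD => //; apply: continuous_comp; last exact: continuous_asin.
    apply: cont_atD; first by apply: cont_atM; exact: cpt.
    by apply: cont_atN; apply: cont_atM; exact: cpt.
  - rewrite aS cosD hc hs cw sw /w.
    transitivity (c (pt k.+1 z) * (c (pt k z) ^+ 2 + s (pt k z) ^+ 2)); first by ring.
    by rewrite cs1 mulr1.
  - rewrite aS sinD hc hs cw sw /w.
    transitivity (s (pt k.+1 z) * (c (pt k z) ^+ 2 + s (pt k z) ^+ 2)); first by ring.
    by rewrite cs1 mulr1.
have := ind n.+1 (leqnn _).
by have -> : pt n.+1 z = z by rewrite /pt divff ?scale1r // gt_eqF.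
Qed.

End PhaseLifting.

Section SpherePhases.
Variable R : realType.
Implicit Types (z : 'rV[R]_2) (v : 'rV[R]_3).

Let sigma z : R := Num.sqrt (1 - (z 0 0 * z 0 0 + z 0 1 * z 0 1)).

(** Wraps the unit disk around the sphere: the centre goes to the north pole and
    the unit circle collapses to the south pole.  Since the square root of a
    negative number is 0, the points outside the disk also go to the south pole
    and the map is continuous on the whole plane. *)
Definition disk_to_sphere z : 'rV[R]_3 :=
  (2 * z 0 0 * sigma z) *: delta_mx 0 0 + (2 * z 0 1 * sigma z) *: delta_mx 0 1
  + (2 * sigma z ^+ 2 - 1) *: delta_mx 0 (inord 2).

Let N z := z 0 0 * z 0 0 + z 0 1 * z 0 1.

Let sigma2 z : N z <= 1 -> sigma z ^+ 2 = 1 - N z.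
Proof. by move=> h; rewrite sqr_sqrtr // subr_ge0. Qed.

Let sigma0 z : 1 <= N z -> sigma z = 0.
Proof. by move=> h; rewrite /sigma ler0_sqrtr // subr_le0. Qed.

Lemma ord3E (i : 'I_3) : [\/ i = 0, i = 1 | i = inord 2].
Proof.
case: i => [[|[|[|//]]]] h; [constructor 1|constructor 2|constructor 3]; apply/val_inj => //.
by rewrite /= inordK.
Qed.

Let i2 : (inord 2 : 'I_3) = 2 :> nat. Proof. by rewrite inordK. Qed.

Lemma dot3E v : dot v v = v 0 0 ^+ 2 + v 0 1 ^+ 2 + v 0 (inord 2) ^+ 2.
Proof.
rewrite /dot !big_ord_recl big_ord0 addr0 !expr2 -!addrA; congr (_ + (_ + _)).
  by congr (v 0 _ * v 0 _); apply/val_inj.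
by congr (v 0 _ * v 0 _); apply/val_inj; rewrite /= i2.
Qed.

Let F0 z : disk_to_sphere z 0 0 = 2 * z 0 0 * sigma z.
Proof. by rewrite !mxE /= -!val_eqE /= i2 /= mulr1 !mulr0 !addr0. Qed.
Let F1 z : disk_to_sphere z 0 1 = 2 * z 0 1 * sigma z.
Proof. by rewrite !mxE /= -!val_eqE /= i2 /= mulr1 !mulr0 addr0 add0r. Qed.
Let F2 z : disk_to_sphere z 0 (inord 2) = 2 * sigma z ^+ 2 - 1.
Proof. by rewrite !mxE /= -!val_eqE /= i2 /= mulr1 !mulr0 !add0r. Qed.

Lemma disk_to_sphere_in z : sphere2 (disk_to_sphere z).
Proof.
rewrite /sphere2 /= dot3E F0 F1 F2.
have [h|/ltW h] := leP (N z) 1; last by rewrite (sigma0 h); ring.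
transitivity (4 * sigma z ^+ 2 * (N z + sigma z ^+ 2 - 1) + 1); first by rewrite /N; ring.
by rewrite (sigma2 h); ring.
Qed.

Lemma disk_to_sphere_continuous : continuous disk_to_sphere.
Proof.
move=> z.
have c (i : 'I_2) : {for z, continuous (fun z : 'rV[R]_2 => z 0 i)}.
  exact: coord_continuous.
have cs : {for z, continuous sigma}.
  apply: continuous_comp; last exact: sqrt_continuous.
  apply: cont_atD; first exact: cont_atC.
  by apply: cont_atN; apply: cont_atD; apply: cont_atM; exact: c.
have c2 (i : 'I_2) : {for z, continuous (fun z : 'rV[R]_2 => 2 * z 0 i * sigma z)}.
  by apply: cont_atM => //; apply: cont_atM; [exact: cont_atC|exact: c].
have c3 : {for z, continuous (fun z : 'rV[R]_2 => 2 * sigma z ^+ 2 - 1)}.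
  apply: cont_atD; last by exact: cont_atC.
  by apply: cont_atM; [exact: cont_atC|exact: (cont_atM cs cs)].
have cZ (f : 'rV[R]_2 -> R) (v : 'rV[R]_3) : {for z, continuous f} ->
    {for z, continuous (fun y => f y *: v)} by move=> cf; exact: cvgZr_tmp cf.
exact: (cvgD (cvgD (cZ _ _ (c2 0)) (cZ _ _ (c2 1))) (cZ _ _ c3)).
Qed.

Lemma disk_to_sphere_surj v : sphere2 v ->
  exists2 z : 'rV[R]_2, z 0 0 * z 0 0 + z 0 1 * z 0 1 <= 1 & disk_to_sphere z = v.
Proof.
rewrite /sphere2 /= dot3E => v1; set c := v 0 (inord 2) in v1.
have sq0 := sqr_ge0 (v 0 0); have sq1 := sqr_ge0 (v 0 1).
have c1 : - 1 <= c <= 1.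
  by rewrite -ler_norml -(@expr_le1 _ 2) // real_normK ?num_real // -v1 lerDr addr_ge0.
have [cN|cN] := eqVneq c (- 1).
  have /eqP : v 0 0 ^+ 2 + v 0 1 ^+ 2 = 0 by rewrite cN sqrrN expr1n in v1; lra.
  rewrite paddr_eq0 // !sqrf_eq0 => /andP[/eqP v0 /eqP v10].
  exists (delta_mx 0 0); first by rewrite !mxE /= mulr1 mulr0 addr0.
  have s0 : sigma (delta_mx 0 0) = 0 by apply: sigma0; rewrite /N !mxE /= mulr1 mulr0 addr0.
  apply/rowP => i; case: (ord3E i) => ->; rewrite ?F0 ?F1 ?F2 s0 ?mulr0 ?v0 ?v10 //.
  by rewrite expr0n /= mulr0 sub0r -cN.
pose t := Num.sqrt ((1 + c) / 2).
have c0 : 0 < 1 + c by rewrite lt_neqAle -subr_eq0 sub0r oppr_eq0 addrC addr_eq0 cN; lra.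
have t2 : t ^+ 2 = (1 + c) / 2 by rewrite sqr_sqrtr //; lra.
have t0 : t != 0 by rewrite sqrtr_eq0 -ltNge; lra.
pose z : 'rV[R]_2 := (v 0 0 / (2 * t)) *: delta_mx 0 0 + (v 0 1 / (2 * t)) *: delta_mx 0 1.
have z0 : z 0 0 = v 0 0 / (2 * t) by rewrite !mxE /= mulr1 mulr0 addr0.
have z1 : z 0 1 = v 0 1 / (2 * t) by rewrite !mxE /= mulr1 mulr0 add0r.
have Nz : N z = 1 - t ^+ 2.
  have n0 : 4 * t ^+ 2 != 0 by rewrite mulf_neq0 // expf_neq0.
  apply: (mulfI n0); transitivity (v 0 0 ^+ 2 + v 0 1 ^+ 2).
    by rewrite /N z0 z1; field.
  rewrite t2; have -> : v 0 0 ^+ 2 + v 0 1 ^+ 2 = 1 - c ^+ 2 by rewrite -v1 addrK.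
  by field.
have Nz1 : N z <= 1 by rewrite Nz gerBl sqr_ge0.
have sz : sigma z = t.
  rewrite /sigma -/(N z) Nz opprB addrC subrK sqrtr_sqr ger0_norm // sqrtr_ge0 //.
exists z => //; apply/rowP => i; case: (ord3E i) => ->.
- by rewrite F0 sz z0; field.
- by rewrite F1 sz z1; field.
- by rewrite F2 sz t2 -/c; field.
Qed.

Lemma disk_to_sphere_inj z z' : N z <= 1 -> N z' <= 1 ->
  disk_to_sphere z = disk_to_sphere z' -> z = z' \/ N z = 1 /\ N z' = 1.
Proof.
move=> Nz Nz' E.
have s2 : sigma z ^+ 2 = sigma z' ^+ 2.
  have := congr1 (fun v : 'rV[R]_3 => v 0 (inord 2)) E; rewrite !F2; lra.
have [s0|s0] := eqVneq (sigma z) 0.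
  right; move: s2; rewrite s0 sigma2 // => h; split; last by rewrite expr0n /= in h; lra.
  by have := sigma2 Nz; rewrite s0 expr0n /=; lra.
have ss : sigma z = sigma z'.
  by apply/eqP; rewrite -(@eqrXn2 _ 2) // ?sqrtr_ge0 //; exact/eqP.
left; have s0' : 2 * sigma z != 0 by rewrite mulf_neq0 // pnatr_eq0.
have h0 := congr1 (fun v : 'rV[R]_3 => v 0 0) E.
have h1 := congr1 (fun v : 'rV[R]_3 => v 0 1) E.
rewrite /= !(F0, F1) -ss !(mulrC 2) -!mulrA in h0 h1.
apply/rowP => i; case: (ord2E i) => ->; exact: (mulIf s0').
Qed.

Lemma disk_to_sphere_boundary z z' : N z = 1 -> N z' = 1 ->
  disk_to_sphere z = disk_to_sphere z'.
Proof.
by move=> Nz Nz'; rewrite /disk_to_sphere !sigma0 ?Nz ?Nz' // !mulr0 !scale0r.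
Qed.

End SpherePhases.

Section TopologicalSphere.
Variables (R : realType) (T : topologicalType).
Hypothesis hT : hausdorff_space T.
Hypothesis TS : homeomorphic_to_set T (@sphere2 R).

Let disk : set 'rV[R]_2 := [set z | z 0 0 * z 0 0 + z 0 1 * z 0 1 <= 1].

Lemma disk_norm z : disk z -> `|z| < 2.
Proof.
move=> Nz; have h := rV2_sqr_ge (normr_ge0 z) (lexx `|z|).
have {}h := le_trans h Nz.
have : `|z| <= 1 by rewrite -(@expr_le1 _ 2).
by move=> /le_lt_trans; apply; rewrite ltr1n.
Qed.

Lemma disk_closed : closed disk.
Proof.
pose N (z : 'rV[R]_2) := z 0 0 * z 0 0 + z 0 1 * z 0 1.
have cN : continuous N.
  have c (i : 'I_2) : continuous (fun z : 'rV[R]_2 => z 0 i) by exact: coord_continuous.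
  by move=> z; exact: cont_atD (cont_atM (c 0 z) (c 0 z)) (cont_atM (c 1 z) (c 1 z)).
rewrite (_ : disk = N @^-1` `]-oo, 1]); last first.
  by apply/seteqP; split=> z; rewrite /= in_itv.
by apply: preimage_closed; [move=> z _; exact: cN|exact: interval_closed].
Qed.

Lemma disk_compact : compact disk.
Proof.
apply: bounded_closed_compact; last exact: disk_closed.
exists 2; split; first exact: num_real.
by move=> x x2 z /disk_norm /ltW /le_trans; apply; exact: ltW.
Qed.

Lemma disk_param : exists G : 'rV[R]_2 -> T, [/\ continuous G,
  (forall t, exists2 z, disk z & G z = t),
  forall z z', disk z -> disk z' -> G z = G z' -> z = z' \/
    z 0 0 * z 0 0 + z 0 1 * z 0 1 = 1 /\ z' 0 0 * z' 0 0 + z' 0 1 * z' 0 1 = 1 &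
  forall z z' : 'rV[R]_2, z 0 0 * z 0 0 + z 0 1 * z 0 1 = 1 ->
    z' 0 0 * z' 0 0 + z' 0 1 * z' 0 1 = 1 -> G z = G z'].
Proof.
have [f [g [cf cg fS fK gK]]] := TS.
exists (fun z => g (disk_to_sphere z)); split.
- move=> z P nP.
  have h : nbhs (disk_to_sphere z) (fun u => sphere2 u -> P (g u)) :=
    (subspace_continuousP _ _).1 cg _ (disk_to_sphere_in z) P nP.
  have h2 : nbhs z (fun y => sphere2 (disk_to_sphere y) -> P (g (disk_to_sphere y))) :=
    @disk_to_sphere_continuous R z _ h.
  by move: h2; apply: filterS => y; apply; exact: disk_to_sphere_in.
- move=> t; have [z Dz E] := disk_to_sphere_surj (fS t).
  by exists z => //; rewrite E fK.
- move=> z z' Dz Dz' /(congr1 f); rewrite !gK; try exact: disk_to_sphere_in.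
  exact: disk_to_sphere_inj.
- by move=> z z' Nz Nz'; rewrite (disk_to_sphere_boundary Nz Nz').
Qed.

Lemma sphere_compact : compact [set: T].
Proof.
have [G [cG Gsurj _ _]] := disk_param.
have -> : [set: T] = G @` disk.
  by apply/esym/seteqP; split=> // t _; have [z Dz <-] := Gsurj t; exists z.
by apply: continuous_compact disk_compact; exact: continuous_subspaceT.
Qed.

(** The sphere is an image of the plane, and two points of the plane are joined
    by a line. *)
Lemma sphere_clopen (A : set T) : open A -> closed A -> A !=set0 -> A = setT.
Proof.
move=> oA cA [t0 At0]; apply/seteqP; split=> // t _.
have [G [cG Gsurj _ _]] := disk_param.
have [z0 _ E0] := Gsurj t0; have [z _ <-] := Gsurj t.
pose l (r : R) := G (z0 + r *: (z - z0)).
have cl : continuous l.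
  move=> r; apply: (@continuous_comp _ _ _ (fun r : R => z0 + r *: (z - z0)) G);
    last exact: cG.
  have h : (fun r : R => r *: (z - z0)) @ r --> r *: (z - z0) by exact: scalel_continuous.
  by apply: cvgD; [exact: cvg_cst|exact: h].
have cR : connected [set: R] by apply/connected_intervalP; move=> ? ? _ _.
have : l @^-1` A = setT.
  apply: cR.
  - by exists 0; rewrite /l /= scale0r addr0 E0.
  - exists (l @^-1` A); last by rewrite setTI.
    by apply: open_comp => // ? _; exact: cl.
  - exists (l @^-1` A); last by rewrite setTI.
    by apply: preimage_closed => // ? _; exact: cl.
move=> /seteqP[_ /(_ 1 I)]; by rewrite /l /= scale1r addrC subrK.
Qed.

(** Pulled back to the disk, the phase lifts to an angle.  On the boundary circle
    the phase is constant, hence so is the angle, which therefore descends to the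
    sphere; it is continuous there because the images of compact sets are
    closed. *)
Lemma sphere_phase_lift (c s : T -> R) : continuous c -> continuous s ->
  (forall t, c t ^+ 2 + s t ^+ 2 = 1) ->
  exists2 a : T -> R, continuous a & forall t, cos (a t) = c t /\ sin (a t) = s t.
Proof.
move=> cc cs cs1; have [G [cG Gsurj Ginj Gbd]] := disk_param.
have ccG : continuous (c \o G) by move=> z; apply: continuous_comp; [exact: cG|exact: cc].
have csG : continuous (s \o G) by move=> z; apply: continuous_comp; [exact: cG|exact: cs].
have [b hb] := plane_phase_lift 2 ccG csG (fun z => cs1 (G z)).
have bG z z' : disk z -> disk z' -> G z = G z' -> b z = b z'.
  move=> Dz Dz' E; have [->//|[Nz Nz']] := Ginj _ _ Dz Dz' E.
  pose circ (t : R) : 'rV[R]_2 := cos t *: delta_mx 0 0 + sin t *: delta_mx 0 1.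
  have c0 t : circ t 0 0 = cos t by rewrite !mxE /= mulr1 mulr0 addr0.
  have c1 t : circ t 0 1 = sin t by rewrite !mxE /= mulr1 mulr0 add0r.
  have Nc t : circ t 0 0 * circ t 0 0 + circ t 0 1 * circ t 0 1 = 1.
    by rewrite c0 c1 -!expr2 cos2Dsin2.
  have Dc t : disk (circ t) by rewrite /disk /= Nc.
  have circ_surj (y : 'rV[R]_2) : y 0 0 * y 0 0 + y 0 1 * y 0 1 = 1 -> exists t, circ t = y.
    move=> Ny; have [t ct st] := @phase_exists R (y 0 0) (y 0 1) Ny.
    by exists t; apply/rowP => i; case: (ord2E i) => ->; rewrite ?c0 ?c1.
  have ccirc : continuous circ.
    move=> t; have h0 := @continuous_cos R t; have h1 := @continuous_sin R t.
    have k0 : (fun x : R => cos x *: (delta_mx 0 0 : 'rV[R]_2)) @ t -->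
        cos t *: (delta_mx 0 0 : 'rV[R]_2).
      exact: cvgZr_tmp h0.
    have k1 : (fun x : R => sin x *: (delta_mx 0 1 : 'rV[R]_2)) @ t -->
        sin t *: (delta_mx 0 1 : 'rV[R]_2).
      exact: cvgZr_tmp h1.
    by apply: cvgD; [exact: k0|exact: k1].
  have Gc t : G (circ t) = G z'.
    exact: Gbd.
  have cb : continuous (b \o circ).
    move=> t; apply: continuous_comp; first exact: ccirc.
    by have [] := hb _ (disk_norm (Dc t)).
  have [t <-] := circ_surj z Nz; have [t' <-] := circ_surj z' Nz'.
  apply: (phase_constant cb) => {t t'} t /=.
    by have [_ -> _] := hb _ (disk_norm (Dc t)); rewrite /= Gc.
  by have [_ _ ->] := hb _ (disk_norm (Dc t)); rewrite /= Gc.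
pose pre t := sval (cid2 (Gsurj t)).
have preD t : disk (pre t) by rewrite /pre; case: cid2.
have preG t : G (pre t) = t by rewrite /pre; case: cid2.
exists (b \o pre); last first.
  move=> t; have [_ /= -> ->] := hb _ (disk_norm (preD t)); by rewrite preG.
apply/continuous_closedP => A cA.
have -> : (b \o pre) @^-1` A = G @` (disk `&` b @^-1` A).
  apply/seteqP; split=> [t /= At|_ [z [Dz Az] <-]] /=.
    by exists (pre t) => //; split.
  by rewrite (bG _ z) ?preG.
apply: compact_closed => //; apply: continuous_compact.
  exact: continuous_subspaceT.
apply: (subclosed_compact _ disk_compact); last by move=> z [].
move=> z clz.
have Dz : disk z by apply: disk_closed => B /clz[y [[Dy _] By]]; exists y.
have [cb _ _] := hb z (disk_norm Dz).
split=> //; apply: cA => B /cb nB.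
have [y [[_ Ay] By]] := clz _ nB.
by exists (b y).
Qed.

End TopologicalSphere.

(** * Hermitian algebra of the complex plane of dimension two *)

Section HermitianAlgebra.
Variable R : realType.
Implicit Types a b c d u v w : C2 R.

Definition cx1 v : R := v 0 (lshift 2 0).
Definition cx2 v : R := v 0 (lshift 2 1).
Definition cy1 v : R := v 0 (rshift 2 0).
Definition cy2 v : R := v 0 (rshift 2 1).

(** Real and imaginary parts of the complex determinant of two vectors, that is,
    of the holomorphic volume form. *)
Definition Re_det u v : R :=
  cx1 u * cx2 v - cy1 u * cy2 v - (cx2 u * cx1 v - cy2 u * cy1 v).
Definition Im_det u v : R :=
  cx1 u * cy2 v + cy1 u * cx2 v - (cx2 u * cy1 v + cy2 u * cx1 v).

Lemma dotC2E u v :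
  dot u v = cx1 u * cx1 v + cx2 u * cx2 v + cy1 u * cy1 v + cy2 u * cy2 v.
Proof.
rewrite /dot big_split_ord /= !big_ord_recl !big_ord0 !addr0 -!addrA.
by congr (u 0 _ * v 0 _ + (u 0 _ * v 0 _ + (u 0 _ * v 0 _ + u 0 _ * v 0 _))); apply/val_inj.
Qed.

Lemma cx1J v : cx1 (complexJ v) = - cy1 v.
Proof. by rewrite /cx1 row_mxEl !mxE. Qed.
Lemma cx2J v : cx2 (complexJ v) = - cy2 v.
Proof. by rewrite /cx2 row_mxEl !mxE. Qed.
Lemma cy1J v : cy1 (complexJ v) = cx1 v.
Proof. by rewrite /cy1 row_mxEr !mxE. Qed.
Lemma cy2J v : cy2 (complexJ v) = cx2 v.
Proof. by rewrite /cy2 row_mxEr !mxE. Qed.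

Definition C2E := (dotC2E, cx1J, cx2J, cy1J, cy2J).

Lemma dotC2C u v : dot u v = dot v u.
Proof. by rewrite !C2E; ring. Qed.

Lemma dotJr u v : dot u (complexJ v) = - dot (complexJ u) v.
Proof. by rewrite !C2E; ring. Qed.

Lemma dotJid v : dot (complexJ v) v = 0.
Proof. by rewrite !C2E; ring. Qed.

Lemma dotJC u v : dot (complexJ u) v = - dot (complexJ v) u.
Proof. by rewrite !C2E; ring. Qed.

(** The product of a determinant with the conjugate of another one is the
    determinant of the Hermitian products, whose imaginary parts are given by
    [complexJ]. *)
Lemma Im_conj_det a b c d :
  Re_det a b * Im_det c d - Im_det a b * Re_det c d =
  dot c a * dot d (complexJ b) + dot c (complexJ a) * dot d b
  - dot c b * dot d (complexJ a) - dot c (complexJ b) * dot d a.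
Proof. by rewrite /Re_det /Im_det !C2E; ring. Qed.

(** The modulus of the determinant is sin theta times the area, where theta is the
    Kaehler angle of the plane spanned by [a] and [b]. *)
Lemma norm_det a b : Re_det a b ^+ 2 + Im_det a b ^+ 2 =
  dot a a * dot b b - dot a b ^+ 2 - dot (complexJ a) b ^+ 2.
Proof. by rewrite /Re_det /Im_det !C2E; ring. Qed.

Lemma gram_ge0 a b : 0 <= dot a a * dot b b - dot a b ^+ 2.
Proof.
rewrite -[X in 0 <= X](subrK (dot (complexJ a) b ^+ 2)) -norm_det.
by rewrite !addr_ge0 // sqr_ge0.
Qed.

Lemma dot_eq0 v : dot v v = 0 -> v = 0.
Proof.
move=> /eqP; rewrite /dot psumr_eq0; last by move=> i _; rewrite -expr2 sqr_ge0.
move=> /allP /= h; apply/rowP => i; have := h i (mem_index_enum _).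
by rewrite /= -expr2 sqrf_eq0 => /eqP ->; rewrite mxE.
Qed.

(** As [a], [b], [J a] and [J b] form a basis, the squared norm of [v] is a
    quadratic form in its products with them; clearing the denominator, which is
    the squared modulus of the determinant, gives a polynomial identity. *)
Lemma complex_basis_orthogonal a b v :
  Re_det a b ^+ 2 + Im_det a b ^+ 2 != 0 ->
  dot v a = 0 -> dot v b = 0 -> dot (complexJ v) a = 0 -> dot (complexJ v) b = 0 ->
  v = 0.
Proof.
move=> D0 va vb Jva Jvb; apply: dot_eq0; apply: (mulfI D0); rewrite mulr0.
pose al := dot v a; pose be := dot (complexJ v) a.
pose ga := dot v b; pose de := dot (complexJ v) b.
transitivity (dot a a * (ga ^+ 2 + de ^+ 2) + dot b b * (al ^+ 2 + be ^+ 2)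
   - 2 * dot a b * (al * ga + be * de) - 2 * dot (complexJ a) b * (al * de - be * ga)).
  by rewrite /al /be /ga /de /Re_det /Im_det !C2E; ring.
by rewrite /al /be /ga /de va vb Jva Jvb; ring.
Qed.

End HermitianAlgebra.

Section VectorGradients.
Variable R : realType.
Implicit Types (X Y : 'rV[R]_2 -> C2 R) (q : 'rV[R]_2).

Lemma grad_at_entry X q i : differentiable X q ->
  grad_at (fun p => X p 0 i) q ('D_e0 X q 0 i) ('D_e1 X q 0 i).
Proof.
move=> dX; have D v : 'D_v (fun p => X p 0 i) q = 'D_v X q 0 i.
  by rewrite (derive_mx (diff_derivable dX)) mxE.
split; rewrite ?D //.
exact: (differentiable_comp dX (differentiable_coord _ _ _)).
Qed.

Lemma grad_at_dot X Y q : differentiable X q -> differentiable Y q ->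
  grad_at (fun p => dot (X p) (Y p)) q
    (dot ('D_e0 X q) (Y q) + dot (X q) ('D_e0 Y q))
    (dot ('D_e1 X q) (Y q) + dot (X q) ('D_e1 Y q)).
Proof.
move=> dX dY; have hX := fun i => grad_at_entry i dX.
have hY := fun i => grad_at_entry i dY.
rewrite (_ : (fun p => _) = fun p => cx1 (X p) * cx1 (Y p) + cx2 (X p) * cx2 (Y p)
   + cy1 (X p) * cy1 (Y p) + cy2 (X p) * cy2 (Y p)); last first.
  by apply/funext => p; rewrite dotC2E.
apply: grad_at_eq.
  exact: (grad_atD (grad_atD (grad_atD (grad_atM (hX _) (hY _)) (grad_atM (hX _) (hY _)))
    (grad_atM (hX _) (hY _))) (grad_atM (hX _) (hY _))).
  rewrite /= !C2E /cx1 /cx2 /cy1 /cy2.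
    by move: ('D_e0 X q) ('D_e0 Y q) (X q) (Y q) => ? ? ? ?; ring.
rewrite /= !C2E /cx1 /cx2 /cy1 /cy2.
    by move: ('D_e1 X q) ('D_e1 Y q) (X q) (Y q) => ? ? ? ?; ring.
Qed.

Lemma grad_at_dotJ X Y q : differentiable X q -> differentiable Y q ->
  grad_at (fun p => dot (complexJ (X p)) (Y p)) q
    (dot (complexJ ('D_e0 X q)) (Y q) + dot (complexJ (X q)) ('D_e0 Y q))
    (dot (complexJ ('D_e1 X q)) (Y q) + dot (complexJ (X q)) ('D_e1 Y q)).
Proof.
move=> dX dY; have hX := fun i => grad_at_entry i dX.
have hY := fun i => grad_at_entry i dY.
rewrite (_ : (fun p => _) = fun p => - cy1 (X p) * cx1 (Y p) + - cy2 (X p) * cx2 (Y p)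
   + cx1 (X p) * cy1 (Y p) + cx2 (X p) * cy2 (Y p)); last first.
  by apply/funext => p; rewrite !C2E.
apply: grad_at_eq.
  exact: (grad_atD (grad_atD (grad_atD (grad_atM (grad_atN (hX _)) (hY _))
    (grad_atM (grad_atN (hX _)) (hY _)))
    (grad_atM (hX _) (hY _))) (grad_atM (hX _) (hY _))).
  rewrite /= !C2E /cx1 /cx2 /cy1 /cy2.
    by move: ('D_e0 X q) ('D_e0 Y q) (X q) (Y q) => ? ? ? ?; ring.
rewrite /= !C2E /cx1 /cx2 /cy1 /cy2.
    by move: ('D_e1 X q) ('D_e1 Y q) (X q) (Y q) => ? ? ? ?; ring.
Qed.

Lemma grad_at_Re_det X Y q : differentiable X q -> differentiable Y q ->
  grad_at (fun p => Re_det (X p) (Y p)) q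
    (Re_det ('D_e0 X q) (Y q) + Re_det (X q) ('D_e0 Y q))
    (Re_det ('D_e1 X q) (Y q) + Re_det (X q) ('D_e1 Y q)).
Proof.
move=> dX dY; have hX := fun i => grad_at_entry i dX.
have hY := fun i => grad_at_entry i dY.
apply: grad_at_eq.
  exact: (grad_atD (grad_atD (grad_atM (hX _) (hY _)) (grad_atN (grad_atM (hX _) (hY _))))
    (grad_atN (grad_atD (grad_atM (hX _) (hY _)) (grad_atN (grad_atM (hX _) (hY _)))))).
  rewrite /= /Re_det /cx1 /cx2 /cy1 /cy2.
    by move: ('D_e0 X q) ('D_e0 Y q) (X q) (Y q) => ? ? ? ?; ring.
rewrite /= /Re_det /cx1 /cx2 /cy1 /cy2.
    by move: ('D_e1 X q) ('D_e1 Y q) (X q) (Y q) => ? ? ? ?; ring.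
Qed.

Lemma grad_at_Im_det X Y q : differentiable X q -> differentiable Y q ->
  grad_at (fun p => Im_det (X p) (Y p)) q
    (Im_det ('D_e0 X q) (Y q) + Im_det (X q) ('D_e0 Y q))
    (Im_det ('D_e1 X q) (Y q) + Im_det (X q) ('D_e1 Y q)).
Proof.
move=> dX dY; have hX := fun i => grad_at_entry i dX.
have hY := fun i => grad_at_entry i dY.
apply: grad_at_eq.
  exact: (grad_atD (grad_atD (grad_atM (hX _) (hY _)) (grad_atM (hX _) (hY _)))
    (grad_atN (grad_atD (grad_atM (hX _) (hY _)) (grad_atM (hX _) (hY _))))).
  rewrite /= /Im_det /cx1 /cx2 /cy1 /cy2.
    by move: ('D_e0 X q) ('D_e0 Y q) (X q) (Y q) => ? ? ? ?; ring.
rewrite /= /Im_det /cx1 /cx2 /cy1 /cy2.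
    by move: ('D_e1 X q) ('D_e1 Y q) (X q) (Y q) => ? ? ? ?; ring.
Qed.

Lemma cont_at_dot (T : topologicalType) (X Y : T -> C2 R) (q : T) :
  {for q, continuous X} -> {for q, continuous Y} ->
  {for q, continuous (fun p => dot (X p) (Y p))}.
Proof.
move=> cX cY.
have co (Z : T -> C2 R) i : {for q, continuous Z} -> {for q, continuous (fun p => Z p 0 i)}.
  move=> cZ; apply: (@continuous_comp _ _ _ Z (fun v : C2 R => v 0 i)) => //.
  exact: coord_continuous.
rewrite (_ : (fun p => _) = fun p => cx1 (X p) * cx1 (Y p) + cx2 (X p) * cx2 (Y p)
   + cy1 (X p) * cy1 (Y p) + cy2 (X p) * cy2 (Y p)); last first.
  by apply/funext => p; rewrite dotC2E.
by do 3 (apply: cont_atD; last by apply: cont_atM; exact: co); apply: cont_atM; exact: co.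
Qed.

End VectorGradients.

(** * Polynomial identities behind the equation of the phase *)

(** The variables stand for the values at a point of the following functions, for
    an immersion X with first derivatives X_0, X_1 and second derivatives X_ij:
    the metric [g00], [g01], [g11]; [k] = <J X_0, X_1>; [f0], [f1] = <X, X_m>;
    [c000], [c010], ... = <X_ij, X_m>; [d000], [d010], ... = <X_ij, J X_m>;
    [l0], [l1] = <J X, X_m>; [l00], ... = <J X, X_ij>; [m00], ... = <X, X_ij>.
    Then [E] is the determinant of the metric, [E0] and [E1] are its derivatives,
    and [C0], [C1] are [E] times the products of L + X with X_0 and X_1, where L is
    the trace of the second derivatives with respect to the metric. *)
Section CurvatureIdentities.
Variable F : realFieldType.
Variables (g00 g01 g11 k f0 f1 : F).
Variables (c000 c001 c010 c011 c110 c111 : F).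
Let E := g00 * g11 - g01 ^+ 2.
Let E0 := 2 * (c000 * g11 + g00 * c011 - g01 * (c001 + c010)).
Let E1 := 2 * (c010 * g11 + g00 * c111 - g01 * (c011 + c110)).
Let C0 := g11 * c000 - 2 * g01 * c010 + g00 * c110 + E * f0.
Let C1 := g11 * c001 - 2 * g01 * c011 + g00 * c111 + E * f1.
Hypothesis E_neq0 : E != 0.

(** The first two hypotheses are the shrinker equation paired with J X_0 and
    J X_1; the last two say that, to first order, [k] is a constant multiple of the
    square root of [E].  The conclusion computes [E] sin^2 theta times the derivatives of the
    phase angle.  In the absence of a constant Kaehler angle the conclusion would
    contain its derivatives: the combinations in the proof subtract exactly these
    terms. *)
Lemma phase_derivative_alg (d000 d001 d010 d011 d110 d111 l0 l1 : F) :
  E * (g11 * d000 - 2 * g01 * d010 + g00 * d110 - E * l0) =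
    k * (- g01 * C0 + g00 * C1) ->
  E * (g11 * d001 - 2 * g01 * d011 + g00 * d111 - E * l1) =
    - k * (g11 * C0 - g01 * C1) ->
  2 * E * (d010 - d001) = k * E0 -> 2 * E * (d110 - d011) = k * E1 ->
  g11 * d000 - g01 * d001 + g00 * d011 - g01 * d010 - k * c001 + k * c010 =
    E * l0 + k * (g00 * f1 - g01 * f0) /\
  g11 * d010 - g01 * d011 + g00 * d111 - g01 * d110 - k * c011 + k * c110 =
    E * l1 + k * (g01 * f1 - g11 * f0).
Proof.
move=> /eqP; rewrite -subr_eq0 => /eqP H0 /eqP; rewrite -subr_eq0 => /eqP H1.
move=> /eqP; rewrite -subr_eq0 => /eqP K0 /eqP; rewrite -subr_eq0 => /eqP K1.
have E2 : 2 * E != 0 by rewrite mulf_neq0 // pnatr_eq0.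
split; apply/eqP; rewrite -subr_eq0; apply/eqP; apply: (mulfI E2); rewrite mulr0.
  transitivity (2 * (E * (g11 * d000 - 2 * g01 * d010 + g00 * d110 - E * l0) -
      k * (- g01 * C0 + g00 * C1)) - (- g01 * (2 * E * (d010 - d001) - k * E0)
      + g00 * (2 * E * (d110 - d011) - k * E1))).
    by rewrite /C0 /C1 /E0 /E1 /E; ring.
  by rewrite H0 K0 K1; ring.
transitivity (2 * (E * (g11 * d001 - 2 * g01 * d011 + g00 * d111 - E * l1) -
    - k * (g11 * C0 - g01 * C1)) + (g11 * (2 * E * (d010 - d001) - k * E0)
    - g01 * (2 * E * (d110 - d011) - k * E1))).
  by rewrite /C0 /C1 /E0 /E1 /E; ring.
by rewrite H1 K0 K1; ring.
Qed.

(** The first hypothesis is the shrinker equation paired with J X.  Here [n0] and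
    [n1] are the derivatives of the phase angle times [E] sin^2 theta, and [nij]
    is the derivative of [ni] in the direction [j]; the conclusion says that the
    drift Laplacian of the phase angle vanishes, multiplied by a power of [E] to
    clear denominators. *)
Lemma phase_laplacian_alg (k0 k1 l0 l1 l00 l01 l11 m00 m01 m11 : F) :
  E * (g11 * l00 - 2 * g01 * l01 + g00 * l11) =
    g11 * l0 * C0 - g01 * (l0 * C1 + l1 * C0) + g00 * l1 * C1 ->
  2 * E * k0 = k * E0 -> 2 * E * k1 = k * E1 ->
  let n0 := E * l0 + k * (g00 * f1 - g01 * f0) in
  let n1 := E * l1 + k * (g01 * f1 - g11 * f0) in
  let n00 := E0 * l0 + E * l00 + k0 * (g00 * f1 - g01 * f0) + k * (2 * c000 * f1
      + g00 * (g01 + m01) - (c001 + c010) * f0 - g01 * (g00 + m00)) in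
  let n01 := E1 * l0 + E * (l01 - k) + k1 * (g00 * f1 - g01 * f0) + k * (2 * c010 * f1
      + g00 * (g11 + m11) - (c011 + c110) * f0 - g01 * (g01 + m01)) in
  let n10 := E0 * l1 + E * (k + l01) + k0 * (g01 * f1 - g11 * f0) + k * ((c001 + c010) * f1
      + g01 * (g01 + m01) - 2 * c011 * f0 - g11 * (g00 + m00)) in
  let n11 := E1 * l1 + E * l11 + k1 * (g01 * f1 - g11 * f0) + k * ((c011 + c110) * f1
      + g01 * (g11 + m11) - 2 * c111 * f0 - g11 * (g01 + m01)) in
  E * (g11 * n00 - g01 * (n01 + n10) + g00 * n11)
  - (E0 * (g11 * n0 - g01 * n1) + E1 * (- g01 * n0 + g00 * n1))
  - ((g11 * C0 - g01 * C1) * n0 + (- g01 * C0 + g00 * C1) * n1) = 0.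
Proof.
move=> /eqP; rewrite -subr_eq0 => /eqP HJ.
move=> /eqP; rewrite -subr_eq0 => /eqP K0 /eqP; rewrite -subr_eq0 => /eqP K1.
move=> n0 n1 n00 n01 n10 n11; apply: (@mulfI _ 2); first by rewrite pnatr_eq0.
transitivity (2 * E * (E * (g11 * l00 - 2 * g01 * l01 + g00 * l11) -
    (g11 * l0 * C0 - g01 * (l0 * C1 + l1 * C0) + g00 * l1 * C1))
  + E * f1 * (2 * E * k0 - k * E0) - E * f0 * (2 * E * k1 - k * E1)).
  by rewrite /n0 /n1 /n00 /n01 /n10 /n11 /C0 /C1 /E0 /E1 /E; ring.
by rewrite HJ K0 K1; ring.
Qed.

End CurvatureIdentities.

(** * The phase of a self-shrinker in a chart *)

Section ShrinkerEquation.
Variable R : realType.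
Implicit Types (X : 'rV[R]_2 -> C2 R) (q : 'rV[R]_2) (u v w : C2 R).

Lemma dotDl u v w : dot (u + v) w = dot u w + dot v w.
Proof. by rewrite /dot -big_split; apply: eq_bigr => i _; rewrite mxE mulrDl. Qed.
Lemma dotZl (k : R) u w : dot (k *: u) w = k * dot u w.
Proof. by rewrite /dot mulr_sumr; apply: eq_bigr => i _; rewrite mxE mulrA. Qed.
Lemma dotNl u w : dot (- u) w = - dot u w.
Proof. by rewrite -scaleN1r dotZl mulN1r. Qed.

Lemma sum2E (V : zmodType) (F : 'I_2 -> V) : \sum_(i < 2) F i = F 0 + F 1.
Proof.
rewrite big_ord_recl big_ord1; congr (F _ + F _); exact/val_inj.
Qed.

Lemma invmx2E (A : 'M[R]_2) : \det A != 0 ->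
  [/\ invmx A 0 0 = A 1 1 / \det A, invmx A 0 1 = - A 0 1 / \det A,
      invmx A 1 0 = - A 1 0 / \det A & invmx A 1 1 = A 0 0 / \det A].
Proof.
move=> d0; pose B : 'M[R]_2 := \matrix_(i, j)
  ((if i == j then A (1 - i) (1 - i) else - A i j) / \det A).
have AB : A *m B = 1%:M.
  apply/matrixP => i j; rewrite !mxE sum2E !mxE.
  have d0' := d0; rewrite det2 in d0'.
  by case: (ord2E i) => ->; case: (ord2E j) => ->; rewrite /= ?subr0 ?subrr det2; field.
have uA : A \in unitmx by rewrite unitmxE unitfE.
have -> : invmx A = B by rewrite -[B](mulKmx uA) AB mulmx1.
by rewrite !mxE /= subr0 subrr.
Qed.

Lemma pushforwardE X q a : differentiable X q -> Defs.pushforward X q a = 'D_a X q.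
Proof. by move=> dX; rewrite /Defs.pushforward derivemxE. Qed.

Lemma metric_mxE2 X q i j : differentiable X q ->
  metric_mx X q i j = dot ('D_(delta_mx 0 i) X q) ('D_(delta_mx 0 j) X q).
Proof. by move=> dX; rewrite mxE /induced_metric !pushforwardE. Qed.

(** The shrinker equation paired with an arbitrary vector [w] and cleared of
    denominators.  The equation says that the vector paired by [H] is tangent to
    the surface, so its product with [w] is determined by its products with the
    tangent vectors [X0] and [X1]. *)
Lemma shrinker_pairing X q w (X0 X1 X00 Xm X11 : C2 R) : differentiable X q ->
  'D_e0 X q = X0 -> 'D_e1 X q = X1 -> 'D_e0 ('D_e0 X) q = X00 ->
  'D_e0 ('D_e1 X) q = Xm -> 'D_e1 ('D_e0 X) q = Xm -> 'D_e1 ('D_e1 X) q = X11 ->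
  let g00 := dot X0 X0 in let g01 := dot X0 X1 in let g11 := dot X1 X1 in
  let E := g00 * g11 - g01 ^+ 2 in
  let H v := g11 * dot X00 v - 2 * g01 * dot Xm v + g00 * dot X11 v
     + E * dot (X q) v in
  E != 0 -> mean_curvature X q = - normal_proj X q (X q) ->
  E * H w = g11 * dot X0 w * H X0 - g01 * (dot X0 w * H X1 + dot X1 w * H X0)
     + g00 * dot X1 w * H X1.
Proof.
move=> dX D0 D1 D00 D01 D10 D11 g00 g01 g11 E H E0 HX.
have gE := metric_mxE2 _ _ dX.
have g10 : dot X1 X0 = g01 by rewrite dotC2C.
have dg : \det (metric_mx X q) = E.
  by rewrite det2 !gE D0 D1 g10 /E /g00 /g01 /g11; ring.
have [i00 i01 i10 i11] : [/\ invmx (metric_mx X q) 0 0 = g11 / E,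
  invmx (metric_mx X q) 0 1 = - g01 / E, invmx (metric_mx X q) 1 0 = - g01 / E &
  invmx (metric_mx X q) 1 1 = g00 / E].
  have d0 : \det (metric_mx X q) != 0 by rewrite dg.
  by have [-> -> -> ->] := invmx2E d0; rewrite dg !gE D0 D1 g10.
have npE v : dot (normal_proj X q v) w = dot v w -
   (g11 / E * dot v X0 * dot X0 w - g01 / E * (dot v X1 * dot X0 w + dot v X0 * dot X1 w)
     + g00 / E * dot v X1 * dot X1 w).
  rewrite /normal_proj /tangent_proj !sum2E !pushforwardE // D0 D1 i00 i01 i10 i11.
  by rewrite dotDl dotNl !dotDl !dotZl; congr (_ - _); ring.
have comb (a b a' b' : R) (u v u' v' : C2 R) : a = a' -> b = b' -> u = u' -> v = v' ->
    a *: normal_proj X q u + b *: normal_proj X q v =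
    a' *: normal_proj X q u' + b' *: normal_proj X q v'.
  by move=> -> -> -> ->.
have mcE : mean_curvature X q =
    g11 / E *: normal_proj X q X00 + - g01 / E *: normal_proj X q Xm +
    (- g01 / E *: normal_proj X q Xm + g00 / E *: normal_proj X q X11).
  rewrite /mean_curvature sum2E; congr (_ + _); rewrite sum2E.
    exact: comb i00 i01 D00 D01.
  exact: comb i10 i11 D10 D11.
rewrite {}mcE in HX; move: HX npE.
move: (normal_proj X q) => proj HX npE.
have := congr1 (fun v => dot v w) HX; rewrite !dotDl !dotZl dotNl !npE => eqw.
apply/eqP; rewrite -subr_eq0; apply/eqP.
set L := (X in X = _) in eqw; set L' := (X in _ = X) in eqw.
have {}eqw : L - L' = 0 by rewrite eqw subrr.
rewrite -[RHS](mulr0 (E ^+ 2)) -eqw /L /L' /H; field.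
exact: E0.
Qed.

End ShrinkerEquation.

Lemma grad_at_unique (R : realType) (f g : 'rV[R]_2 -> R) q a0 a1 b0 b1 :
  (\forall p \near q, f p = g p) -> grad_at f q a0 a1 -> grad_at g q b0 b1 ->
  a0 = b0 /\ a1 = b1.
Proof.
by move=> fg [_ <- <-] [_ <- <-]; rewrite !(near_eq_derive _ fg).
Qed.

Lemma grad_at_self (R : realType) (f : 'rV[R]_2 -> R) q a0 a1 :
  grad_at f q a0 a1 -> grad_at f q ('D_e0 f q) ('D_e1 f q).
Proof. by case. Qed.

(** If the angle alpha solves the drift Laplace equation, then [r] = tan alpha
    solves the same equation with a modified first-order term, because its
    derivatives [r0] and [r1] are (1 + r^2) times those of alpha.  Here [n0] and
    [n1] are the derivatives of alpha multiplied by [E] and [s] = sin^2 theta. *)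
Lemma tangent_equation_alg (F : fieldType)
    (g00 g01 g11 E E0 E1 C0 C1 n0 n1 n00 n01 n10 n11 r s : F) :
  E != 0 -> s != 0 ->
  E * (g11 * n00 - g01 * (n01 + n10) + g00 * n11)
  - (E0 * (g11 * n0 - g01 * n1) + E1 * (- g01 * n0 + g00 * n1))
  - ((g11 * C0 - g01 * C1) * n0 + (- g01 * C0 + g00 * C1) * n1) = 0 ->
  let v0 := n0 * E^-1 * s^-1 in let v1 := n1 * E^-1 * s^-1 in
  let v a Ea b := (b * E^-1 - a * E ^- 2 * Ea) * s^-1 in
  let r0 := (1 + r * r) * v0 in let r1 := (1 + r * r) * v1 in
  g11 * ((1 + r * r) * v n0 E0 n00 + v0 * (2 * r * r0))
  - g01 * (((1 + r * r) * v n0 E1 n01 + v0 * (2 * r * r1)) +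
           ((1 + r * r) * v n1 E0 n10 + v1 * (2 * r * r0)))
  + g00 * ((1 + r * r) * v n1 E1 n11 + v1 * (2 * r * r1))
  + (- ((g11 * C0 - g01 * C1) * E^-1) - 2 * r * (g11 * v0 - g01 * v1)) * r0
  + (- ((- g01 * C0 + g00 * C1) * E^-1) - 2 * r * (- g01 * v0 + g00 * v1)) * r1 = 0.
Proof.
move=> E_n0 s_n0 H v0 v1 v r0 r1.
rewrite -[RHS](mulr0 ((1 + r * r) / (s * E ^+ 2))) -H /r0 /r1 /v /v0 /v1; field.
by rewrite E_n0 s_n0.
Qed.

(** The local data of a self-shrinker of constant Kaehler angle with cosine [c]:
    [X0], [X1] are the first derivatives of [X], and [X00], [Xm], [X11] its second
    derivatives.  Keeping them as independent functions leaves only scalar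
    identities between their inner products. *)
Record shrinker_jet (R : realType) (X X0 X1 X00 Xm X11 : 'rV[R]_2 -> C2 R)
    (U : set 'rV[R]_2) (c : R) : Prop := ShrinkerJet {
  jet_open : open U ;
  jet_cos_lt1 : c ^+ 2 < 1 ;
  jet_diff : forall q, U q -> differentiable X q ;
  jet_diff0 : forall q, U q -> differentiable X0 q ;
  jet_diff1 : forall q, U q -> differentiable X1 q ;
  jet_D0 : forall q, U q -> 'D_e0 X q = X0 q ;
  jet_D1 : forall q, U q -> 'D_e1 X q = X1 q ;
  jet_D00 : forall q, U q -> 'D_e0 X0 q = X00 q ;
  jet_D10 : forall q, U q -> 'D_e1 X0 q = Xm q ;
  jet_D01 : forall q, U q -> 'D_e0 X1 q = Xm q ;
  jet_D11 : forall q, U q -> 'D_e1 X1 q = X11 q ;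
  jet_cont00 : forall q, U q -> {for q, continuous X00} ;
  jet_contm : forall q, U q -> {for q, continuous Xm} ;
  jet_cont11 : forall q, U q -> {for q, continuous X11} ;
  jet_gram_gt0 : forall q, U q ->
    0 < dot (X0 q) (X0 q) * dot (X1 q) (X1 q) - dot (X0 q) (X1 q) ^+ 2 ;
  jet_kahler : forall q, U q -> dot (complexJ (X0 q)) (X1 q) =
    c * Num.sqrt (dot (X0 q) (X0 q) * dot (X1 q) (X1 q) - dot (X0 q) (X1 q) ^+ 2) ;
  jet_pairing : forall q w, U q ->
    let g00 := dot (X0 q) (X0 q) in let g01 := dot (X0 q) (X1 q) in
    let g11 := dot (X1 q) (X1 q) in let E := g00 * g11 - g01 ^+ 2 in
    let H v := g11 * dot (X00 q) v - 2 * g01 * dot (Xm q) v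
       + g00 * dot (X11 q) v + E * dot (X q) v in
    E * H w = g11 * dot (X0 q) w * H (X0 q)
      - g01 * (dot (X0 q) w * H (X1 q) + dot (X1 q) w * H (X0 q))
      + g00 * dot (X1 q) w * H (X1 q)
}.

Lemma shrinker_jetS (R : realType) (X X0 X1 X00 Xm X11 : 'rV[R]_2 -> C2 R)
    (U V : set 'rV[R]_2) (c : R) : open V -> V `<=` U ->
  shrinker_jet X X0 X1 X00 Xm X11 U c -> shrinker_jet X X0 X1 X00 Xm X11 V c.
Proof.
move=> oV VU [_ c1 h1 h2 h3 h4 h5 h6 h7 h8 h9 h10 h11 h12 h13 h14 h15].
exact: (ShrinkerJet oV c1 (fun q v => h1 q (VU q v)) (fun q v => h2 q (VU q v))
  (fun q v => h3 q (VU q v)) (fun q v => h4 q (VU q v)) (fun q v => h5 q (VU q v))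
  (fun q v => h6 q (VU q v)) (fun q v => h7 q (VU q v)) (fun q v => h8 q (VU q v))
  (fun q v => h9 q (VU q v)) (fun q v => h10 q (VU q v)) (fun q v => h11 q (VU q v))
  (fun q v => h12 q (VU q v)) (fun q v => h13 q (VU q v)) (fun q v => h14 q (VU q v))
  (fun q w v => h15 q w (VU q v))).
Qed.

Section ChartPhase.
Variable R : realType.
Variables (X X0 X1 X00 Xm X11 : 'rV[R]_2 -> C2 R) (U : set 'rV[R]_2) (c : R).

Local Notation J := (@complexJ R).
Local Notation g00 q := (dot (X0 q) (X0 q)).
Local Notation g01 q := (dot (X0 q) (X1 q)).
Local Notation g11 q := (dot (X1 q) (X1 q)).
Local Notation E q := (g00 q * g11 q - g01 q ^+ 2).
Local Notation kap q := (dot (J (X0 q)) (X1 q)).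
Local Notation f0 q := (dot (X q) (X0 q)).
Local Notation f1 q := (dot (X q) (X1 q)).
Local Notation l0 q := (dot (J (X q)) (X0 q)).
Local Notation l1 q := (dot (J (X q)) (X1 q)).
Local Notation P q := (Re_det (X0 q) (X1 q)).
Local Notation S q := (Im_det (X0 q) (X1 q)).
Local Notation n0 q := (E q * l0 q + kap q * (g00 q * f1 q - g01 q * f0 q)).
Local Notation n1 q := (E q * l1 q + kap q * (g01 q * f1 q - g11 q * f0 q)).
Local Notation E0 q := (2 * (dot (X00 q) (X0 q) * g11 q + g00 q * dot (Xm q) (X1 q)
   - g01 q * (dot (X00 q) (X1 q) + dot (Xm q) (X0 q)))).
Local Notation E1 q := (2 * (dot (Xm q) (X0 q) * g11 q + g00 q * dot (X11 q) (X1 q)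
   - g01 q * (dot (Xm q) (X1 q) + dot (X11 q) (X0 q)))).
Local Notation H q v := (g11 q * dot (X00 q) v - 2 * g01 q * dot (Xm q) v
   + g00 q * dot (X11 q) v + E q * dot (X q) v).

Hypothesis jet : shrinker_jet X X0 X1 X00 Xm X11 U c.
Let oU := jet_open jet.
Let c_lt1 := jet_cos_lt1 jet.
Let dX := jet_diff jet.
Let dX0 := jet_diff0 jet.
Let dX1 := jet_diff1 jet.
Let D0X := jet_D0 jet.
Let D1X := jet_D1 jet.
Let D00X := jet_D00 jet.
Let D10X := jet_D10 jet.
Let D01X := jet_D01 jet.
Let D11X := jet_D11 jet.
Let c00 := jet_cont00 jet.
Let cm := jet_contm jet.
Let c11 := jet_cont11 jet.
Let E_gt0 q : U q -> 0 < E q := @jet_gram_gt0 _ _ _ _ _ _ _ _ _ jet q.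
Let kapE q : U q -> kap q = c * Num.sqrt (E q) := @jet_kahler _ _ _ _ _ _ _ _ _ jet q.
Let pairing q w : U q ->
  E q * H q w = g11 q * dot (X0 q) w * H q (X0 q)
    - g01 q * (dot (X0 q) w * H q (X1 q) + dot (X1 q) w * H q (X0 q))
    + g00 q * dot (X1 q) w * H q (X1 q) := @jet_pairing _ _ _ _ _ _ _ _ _ jet q w.

Lemma sqr_det_phase q : U q -> P q ^+ 2 + S q ^+ 2 = (1 - c ^+ 2) * E q.
Proof.
move=> Uq; rewrite norm_det kapE // exprMn sqr_sqrtr; last exact/ltW/E_gt0.
by ring.
Qed.

Lemma grad_gram q : U q ->
  [/\ grad_at (fun p => g00 p) q (2 * dot (X00 q) (X0 q)) (2 * dot (Xm q) (X0 q)),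
      grad_at (fun p => g01 p) q (dot (X00 q) (X1 q) + dot (Xm q) (X0 q))
        (dot (Xm q) (X1 q) + dot (X11 q) (X0 q)) &
      grad_at (fun p => g11 p) q (2 * dot (Xm q) (X1 q)) (2 * dot (X11 q) (X1 q))].
Proof.
move=> Uq; have h0 := dX0 Uq; have h1 := dX1 Uq.
split; apply: grad_at_eq; try exact: grad_at_dot;
  rewrite ?D00X ?D10X ?D01X ?D11X // ?[dot (X0 q) _]dotC2C ?[dot (X1 q) (_ q)]dotC2C //; ring.
Qed.

Lemma grad_pos q : U q ->
  [/\ grad_at (fun p => f0 p) q (g00 q + dot (X q) (X00 q)) (g01 q + dot (X q) (Xm q)),
      grad_at (fun p => f1 p) q (g01 q + dot (X q) (Xm q)) (g11 q + dot (X q) (X11 q)),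
      grad_at (fun p => l0 p) q (dot (J (X q)) (X00 q)) (dot (J (X q)) (Xm q) - kap q) &
      grad_at (fun p => l1 p) q (kap q + dot (J (X q)) (Xm q)) (dot (J (X q)) (X11 q))].
Proof.
move=> Uq; have h := dX Uq; have h0 := dX0 Uq; have h1 := dX1 Uq.
split; (apply: grad_at_eq; first by [exact: grad_at_dot|exact: grad_at_dotJ]);
  rewrite ?D0X ?D1X ?D00X ?D10X ?D01X ?D11X //.
- by rewrite [dot (X1 q) _]dotC2C.
- by rewrite dotJid add0r.
- by rewrite [dot (J (X1 q)) _]dotJC addrC.
- by rewrite dotJid add0r.
Qed.

Lemma grad_kap q : U q -> grad_at (fun p => kap p) q
  (dot (X00 q) (- J (X1 q)) + dot (Xm q) (J (X0 q)))
  (dot (Xm q) (- J (X1 q)) + dot (X11 q) (J (X0 q))).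
Proof.
move=> Uq; have h0 := dX0 Uq; have h1 := dX1 Uq.
by apply: grad_at_eq; first exact: grad_at_dotJ;
  rewrite ?D00X ?D10X ?D01X ?D11X // ![dot _ (- _)]dotC2C dotNl;
  rewrite [dot (J (X0 q)) _]dotC2C ![dot (J (X1 q)) _]dotC2C ![dot _ (J (X1 q))]dotJr opprK.
Qed.

Lemma grad_E q : U q -> grad_at (fun p => E p) q (E0 q) (E1 q).
Proof.
move=> Uq; have [h00 h01 h11] := grad_gram Uq.
rewrite (_ : (fun p => _) = fun p => g00 p * g11 p + - (g01 p * g01 p)) //.
apply: grad_at_eq; first exact: (grad_atD (grad_atM h00 h11) (grad_atN (grad_atM h01 h01))).
  by rewrite /=; ring.
by rewrite /=; ring.
Qed.

(** The derivative of the relation [kap p = c * Num.sqrt (E p)], freed of the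
    square root and of [c]. *)
Lemma kap_grad q k0 k1 : U q -> grad_at (fun p => kap p) q k0 k1 ->
  2 * E q * k0 = kap q * E0 q /\ 2 * E q * k1 = kap q * E1 q.
Proof.
move=> Uq hk; have hE := grad_E Uq; have Epos := E_gt0 Uq.
have nU : \forall p \near q, U p by exact: open_nbhs_nbhs.
have [c0|c0] := eqVneq c 0.
  have kz p : U p -> kap p = 0 by move=> /kapE ->; rewrite c0 mul0r.
  have nk : \forall p \near q, kap p = 0 by apply: filterS nU.
  have [-> ->] := grad_at_unique nk hk (grad_atC 0 q).
  by rewrite kz // !mulr0 !mul0r.
have kq0 : kap q != 0 by rewrite kapE // mulf_neq0 // sqrtr_eq0 -ltNge.
have nk : \forall p \near q, kap p * kap p = c ^+ 2 * E p.
  apply: filterS nU => p Up.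
  by rewrite kapE // -expr2 exprMn sqr_sqrtr //; exact/ltW/E_gt0.
have [e0 e1] := grad_at_unique nk (grad_atM hk hk) (grad_atM (grad_atC (c ^+ 2) q) hE).
have kk : kap q * kap q = c ^+ 2 * E q.
  by have := nbhs_singleton nk.
rewrite mulr0 addr0 in e0 e1.
split; apply: (mulfI kq0).
  transitivity (E q * (kap q * k0 + kap q * k0)); first by ring.
  by rewrite e0 [RHS]mulrA kk; ring.
transitivity (E q * (kap q * k1 + kap q * k1)); first by ring.
by rewrite e1 [RHS]mulrA kk; ring.
Qed.

(** If alpha is the phase of the determinant [P] + i [S], then
    [P] d[S] - [S] d[P] is its squared modulus times d(alpha); that this is an
    expression in the first derivatives of [X] only is where the shrinker equation
    and the constancy of the Kaehler angle enter. *)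
Lemma det_grad q : U q -> exists P0 P1 S0 S1,
  [/\ grad_at (fun p => P p) q P0 P1, grad_at (fun p => S p) q S0 S1,
      P q * S0 - S q * P0 = n0 q & P q * S1 - S q * P1 = n1 q].
Proof.
move=> Uq; have h0 := dX0 Uq; have h1 := dX1 Uq.
have := grad_at_Re_det h0 h1; have := grad_at_Im_det h0 h1.
rewrite D00X // D10X // D01X // D11X // => hS hP.
exists (Re_det (X00 q) (X1 q) + Re_det (X0 q) (Xm q)),
  (Re_det (Xm q) (X1 q) + Re_det (X0 q) (X11 q)).
exists (Im_det (X00 q) (X1 q) + Im_det (X0 q) (Xm q)),
  (Im_det (Xm q) (X1 q) + Im_det (X0 q) (X11 q)).
have [k0 k1] := kap_grad Uq (grad_kap Uq).
have E0' : E q != 0 by rewrite gt_eqF ?E_gt0.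
have nJ u v : dot u (- J v) = - dot u (J v) by rewrite dotC2C dotNl dotC2C.
rewrite !nJ ![- _ + _]addrC in k0 k1.
have p0 := pairing (J (X0 q)) Uq; have p1 := pairing (J (X1 q)) Uq.
have x0J0 : dot (X0 q) (J (X0 q)) = 0 by rewrite dotC2C dotJid.
have x1J1 : dot (X1 q) (J (X1 q)) = 0 by rewrite dotC2C dotJid.
have x1J0 : dot (X1 q) (J (X0 q)) = kap q by rewrite dotC2C.
have x0J1 : dot (X0 q) (J (X1 q)) = - kap q by rewrite dotJr.
have xJ v : dot (X q) (J v) = - dot (J (X q)) v by rewrite dotJr.
rewrite !xJ x0J0 x1J0 in p0; rewrite !xJ x0J1 x1J1 in p1.
have p0' : E q * (g11 q * dot (X00 q) (J (X0 q)) - 2 * g01 q * dot (Xm q) (J (X0 q))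
    + g00 q * dot (X11 q) (J (X0 q)) - E q * l0 q)
   = kap q * (- g01 q * H q (X0 q) + g00 q * H q (X1 q)).
  by move: p0; rewrite mulrN => ->; ring.
have p1' : E q * (g11 q * dot (X00 q) (J (X1 q)) - 2 * g01 q * dot (Xm q) (J (X1 q))
    + g00 q * dot (X11 q) (J (X1 q)) - E q * l1 q)
   = - kap q * (g11 q * H q (X0 q) - g01 q * H q (X1 q)).
  by move: p1; rewrite mulrN => ->; ring.
have [a0 a1] := phase_derivative_alg E0' p0' p1' k0 k1.
have split_det (a b s t s' t' : R) :
    a * (s + s') - b * (t + t') = (a * s - b * t) + (a * s' - b * t').
  by ring.
split=> //.
  rewrite -a0 split_det !Im_conj_det x0J0 x1J0 x0J1 x1J1.
  by rewrite [dot (X1 q) (X0 q)]dotC2C; ring.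
rewrite -a1 split_det !Im_conj_det x0J0 x1J0 x0J1 x1J1.
by rewrite [dot (X1 q) (X0 q)]dotC2C; ring.
Qed.

(** Since [n0] and [n1] only involve first derivatives of [X], their gradients
    only involve second ones, and no third derivative of [X] ever appears. *)
Lemma grad_n q : U q -> exists n00 n01 n10 n11,
  [/\ grad_at (fun p => n0 p) q n00 n01, grad_at (fun p => n1 p) q n10 n11 &
  E q * (g11 q * n00 - g01 q * (n01 + n10) + g00 q * n11)
  - (E0 q * (g11 q * n0 q - g01 q * n1 q) + E1 q * (- g01 q * n0 q + g00 q * n1 q))
  - ((g11 q * H q (X0 q) - g01 q * H q (X1 q)) * n0 q
     + (- g01 q * H q (X0 q) + g00 q * H q (X1 q)) * n1 q) = 0].
Proof.
move=> Uq.
have [k0 [k1 [hk K0 K1]]] : exists k0 k1, [/\ grad_at (fun p => kap p) q k0 k1,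
    2 * E q * k0 = kap q * E0 q & 2 * E q * k1 = kap q * E1 q].
  by do 2 eexists; have h := grad_kap Uq; have [? ?] := kap_grad Uq h; split; [exact: h|..].
have [h00 h01 h11] := grad_gram Uq; have [hf0 hf1 hl0 hl1] := grad_pos Uq.
have hE := grad_E Uq.
have pJ := pairing (J (X q)) Uq.
have XJ : dot (X q) (J (X q)) = 0 by rewrite dotC2C dotJid.
have hJ : E q * (g11 q * dot (J (X q)) (X00 q) - 2 * g01 q * dot (J (X q)) (Xm q)
     + g00 q * dot (J (X q)) (X11 q)) =
    g11 q * l0 q * H q (X0 q) - g01 q * (l0 q * H q (X1 q) + l1 q * H q (X0 q))
    + g00 q * l1 q * H q (X1 q).
  rewrite !(dotC2C (J (X q))) -pJ XJ; ring.
have alg := phase_laplacian_alg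
  (dot (X q) (X00 q)) (dot (X q) (Xm q)) (dot (X q) (X11 q)) hJ K0 K1.
do 4 eexists; split; [| |exact: alg].
  apply: grad_at_eq; first exact: (grad_atD (grad_atM hE hl0) (grad_atM hk
    (grad_atD (grad_atM h00 hf1) (grad_atN (grad_atM h01 hf0))))).
    by rewrite /=; ring.
  by rewrite /=; ring.
apply: grad_at_eq; first exact: (grad_atD (grad_atM hE hl1) (grad_atM hk
    (grad_atD (grad_atM h01 hf1) (grad_atN (grad_atM h11 hf0))))).
  by rewrite /=; ring.
by rewrite /=; ring.
Qed.

(** With alpha the phase and ([cr], [sr]) the direction of angle alpha0, the
    function [A] / [B] is tan (alpha - alpha0).  It is nonpositive, vanishes at
    [q0] and solves an elliptic equation without zeroth-order term, so the strong
    maximum principle applies.  The tangent avoids any local determination of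
    alpha: it is a rational function of the derivatives of [X]. *)
Lemma phase_rigidity (cr sr : R) q0 : U q0 -> cr ^+ 2 + sr ^+ 2 = 1 ->
  (forall q, U q -> 0 < cr * P q + sr * S q) ->
  (forall q, U q -> cr * S q - sr * P q <= 0) ->
  cr * S q0 - sr * P q0 = 0 ->
  \forall q \near q0, cr * S q - sr * P q = 0.
Proof.
move=> Uq0 cs B_gt0 A_le0 A0.
pose s : R := 1 - c ^+ 2.
have s_n0 : s != 0 by rewrite gt_eqF // subr_gt0.
pose A q := cr * S q + - (sr * P q); pose B q := cr * P q + sr * S q.
pose u q := A q * (B q)^-1.
pose v0 q := n0 q * (E q)^-1 * s^-1; pose v1 q := n1 q * (E q)^-1 * s^-1.
pose u0 q := (1 + u q * u q) * v0 q; pose u1 q := (1 + u q * u q) * v1 q.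
have E_n0 q : U q -> E q != 0 by move=> Uq; rewrite gt_eqF ?E_gt0.
have B_n0 q : U q -> B q != 0 by move=> Uq; rewrite gt_eqF ?B_gt0.
have gu q : U q -> grad_at u q (u0 q) (u1 q).
  move=> Uq; have [P0 [P1 [S0 [S1 [hP hS e0 e1]]]]] := det_grad Uq.
  have hA := grad_atD (grad_atM (grad_atC cr q) hS) (grad_atN (grad_atM (grad_atC sr q) hP)).
  have hB := grad_atD (grad_atM (grad_atC cr q) hP) (grad_atM (grad_atC sr q) hS).
  have AB : A q ^+ 2 + B q ^+ 2 = s * E q.
    rewrite -sqr_det_phase // -[RHS]mul1r -cs /A /B; ring.
  have Bn := B_n0 _ Uq; have En := E_n0 _ Uq.
  have key n (Pk Sk : R) : P q * Sk - S q * Pk = n ->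
      (cr * Sk - sr * Pk) * B q - A q * (cr * Pk + sr * Sk) = n.
    by move=> <-; rewrite -[RHS]mul1r -cs /A /B; ring.
  have fin n (Pk Sk : R) : P q * Sk - S q * Pk = n ->
     A q * (- (B q) ^- 2 * (cr * Pk + sr * Sk)) + (B q)^-1 * (cr * Sk - sr * Pk) =
     (1 + u q * u q) * (n * (E q)^-1 * s^-1).
    move=> /key hn.
    have -> : (1 + u q * u q) = (s * E q) / (B q) ^+ 2 by rewrite -AB /u; field.
    by rewrite -hn; field; rewrite Bn s_n0 En.
  apply: grad_at_eq; first exact: grad_atM hA (grad_atV Bn hB).
    rewrite /u0 /v0 -(fin _ _ _ e0) -/(A q) -/(B q) /=; ring.
  rewrite /u1 /v1 -(fin _ _ _ e1) -/(A q) -/(B q) /=; ring.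
have gv (n E' : 'rV[R]_2 -> R) q a0 a1 E0' E1' : grad_at n q a0 a1 -> grad_at E' q E0' E1' ->
    E' q != 0 -> grad_at (fun p => n p * (E' p)^-1 * s^-1) q
     ((a0 * (E' q)^-1 - n q * E' q ^- 2 * E0') * s^-1)
     ((a1 * (E' q)^-1 - n q * E' q ^- 2 * E1') * s^-1).
  move=> hn hE' En; apply: grad_at_eq.
  - exact: grad_atM (grad_atM hn (grad_atV En hE')) (grad_atC s^-1 q).
  - by rewrite /=; ring.
  - by rewrite /=; ring.
have guu q : U q -> exists u00 u01 u10 u11,
    [/\ grad_at u0 q u00 u01, grad_at u1 q u10 u11 &
     g11 q * u00 + - g01 q * (u01 + u10) + g00 q * u11
     + (- ((g11 q * H q (X0 q) - g01 q * H q (X1 q)) * (E q)^-1)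
        - 2 * u q * (g11 q * v0 q - g01 q * v1 q)) * u0 q
     + (- ((- g01 q * H q (X0 q) + g00 q * H q (X1 q)) * (E q)^-1)
        - 2 * u q * (- g01 q * v0 q + g00 q * v1 q)) * u1 q = 0].
  move=> Uq; have [n00 [n01 [n10 [n11 [hn0 hn1 alg]]]]] := grad_n Uq.
  have hE := grad_E Uq; have hu := gu _ Uq.
  have h1u := grad_atD (grad_atC 1 q) (grad_atM hu hu).
  have hv0 := gv _ _ _ _ _ _ _ hn0 hE (E_n0 _ Uq).
  have hv1 := gv _ _ _ _ _ _ _ hn1 hE (E_n0 _ Uq).
  do 4 eexists; split; [exact: grad_atM h1u hv0|exact: grad_atM h1u hv1|].
  have := tangent_equation_alg (u q) (E_n0 _ Uq) s_n0 alg.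
  by move=> h; rewrite -[RHS]h /u0 /u1 /v0 /v1 /=; ring.
have cg q : U q -> [/\ {for q, continuous (fun p => g00 p)},
    {for q, continuous (fun p => g01 p)} & {for q, continuous (fun p => g11 p)}].
  by move=> /grad_gram[h0 h1 h2]; split; apply: grad_at_continuous; eassumption.
have cE q : U q -> {for q, continuous (fun p => (E p)^-1)}.
  by move=> Uq; exact: (@cont_atV _ _ (fun p => E p) q (E_n0 _ Uq)
    (grad_at_continuous (grad_E Uq))).
have cH q (Y : 'rV[R]_2 -> C2 R) : U q -> differentiable Y q ->
    {for q, continuous (fun p => H p (Y p))}.
  move=> Uq dY; have [g0 g1 g2] := cg _ Uq.
  have cY := differentiable_continuous dY.
  have cX := differentiable_continuous (dX Uq).
  apply: cont_atD; first apply: cont_atD; first apply: cont_atD.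
  - exact: cont_atM g2 (cont_at_dot (c00 Uq) cY).
  - exact: cont_atN (cont_atM (cont_atM (@cont_atC _ _ 2 q) g1) (cont_at_dot (cm Uq) cY)).
  - exact: cont_atM g0 (cont_at_dot (c11 Uq) cY).
  - exact: cont_atM (grad_at_continuous (grad_E Uq)) (cont_at_dot cX cY).
have cv q : U q -> {for q, continuous v0} /\ {for q, continuous v1}.
  move=> Uq; have [n00 [n01 [n10 [n11 [hn0 hn1 _]]]]] := grad_n Uq.
  split; (apply: cont_atM; last exact: cont_atC); apply: cont_atM; try exact: cE.
    exact: grad_at_continuous hn0.
  exact: grad_at_continuous hn1.
have nearu : \forall q \near q0, u q = u q0.
  apply: (@strong_maximum R U u u0 u1 ('D_e0 u0) ('D_e1 u0) ('D_e0 u1) ('D_e1 u1)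
    (fun p => g11 p) (fun p => - g01 p) (fun p => g00 p)
    (fun q => - ((g11 q * H q (X0 q) - g01 q * H q (X1 q)) * (E q)^-1)
        - 2 * u q * (g11 q * v0 q - g01 q * v1 q))
    (fun q => - ((- g01 q * H q (X0 q) + g00 q * H q (X1 q)) * (E q)^-1)
        - 2 * u q * (- g01 q * v0 q + g00 q * v1 q)) q0) => //.
  - by move=> q /guu[? [? [? [? [h _ _]]]]]; exact: grad_at_self h.
  - by move=> q /guu[? [? [? [? [_ h _]]]]]; exact: grad_at_self h.
  - move=> q Uq; have [g0 g1 g2] := cg _ Uq; have [w0 w1] := cv _ Uq.
    have cu := grad_at_continuous (gu _ Uq).
    have H0 := cH _ _ Uq (dX0 Uq); have H1 := cH _ _ Uq (dX1 Uq).
    have ng := cont_atN g1; have c2u := cont_atM (@cont_atC _ _ 2 q) cu.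
    split=> //.
    + apply: cont_atD; apply: cont_atN.
        exact: cont_atM (cont_atD (cont_atM g2 H0) (cont_atN (cont_atM g1 H1))) (cE _ Uq).
      exact: cont_atM c2u (cont_atD (cont_atM g2 w0) (cont_atN (cont_atM g1 w1))).
    + apply: cont_atD; apply: cont_atN.
        exact: cont_atM (cont_atD (cont_atM ng H0) (cont_atM g0 H1)) (cE _ Uq).
      exact: cont_atM c2u (cont_atD (cont_atM ng w0) (cont_atM g0 w1)).
  - move=> q Uq; have Eq := E_gt0 Uq; split; last first.
      by rewrite /= sqrrN mulrC.
    have : 0 <= g11 q by apply: sumr_ge0 => i _; rewrite -expr2 sqr_ge0.
    rewrite /= le_eqVlt => /orP[/eqP g0|//]; move: Eq; rewrite -g0 mulr0 sub0r.
    by rewrite oppr_gt0 ltNge sqr_ge0.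
  - move=> q /guu[? [? [? [? [[_ <- <-] [_ <- <-] eq]]]]]; exact: eq.
  - move=> q Uq; rewrite /u {2}/A A0 mul0r pmulr_lle0 ?invr_gt0 ?B_gt0 //.
    exact: A_le0.
have nU : \forall q \near q0, U q by exact: open_nbhs_nbhs.
near=> q.
have Uq : U q by near: q.
have : u q = u q0 by near: q.
rewrite /u [A q0]A0 mul0r => /eqP; rewrite mulf_eq0 invr_eq0 (negbTE (B_n0 _ Uq)) orbF.
by move=> /eqP.
Unshelve. all: by end_near. Qed.

(** Where the phase is constant, [n0] and [n1] vanish; where moreover [X] is
    normal, they reduce to the products of [J X] with the tangent vectors, so that
    [X] is orthogonal to the whole space. *)
Lemma center_of_constant_phase (cr sr : R) q : U q -> cr ^+ 2 + sr ^+ 2 = 1 ->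
  (\forall p \near q, cr * S p - sr * P p = 0) ->
  f0 q = 0 -> f1 q = 0 -> X q = 0.
Proof.
move=> Uq cs A0 F0 F1.
have [P0 [P1 [S0 [S1 [hP hS e0 e1]]]]] := det_grad Uq.
have hA := grad_atD (grad_atM (grad_atC cr q) hS) (grad_atN (grad_atM (grad_atC sr q) hP)).
have [a0 a1] := grad_at_unique A0 hA (grad_atC 0 q).
have Aq := nbhs_singleton A0; rewrite /= in a0 a1 Aq.
have key n Pk Sk : P q * Sk - S q * Pk = n ->
    cr * Sk + S q * 0 + - (sr * Pk + P q * 0) = 0 -> n = 0.
  rewrite !mulr0 !addr0 => <- h; rewrite -[LHS]mul1r -cs.
  transitivity ((cr * P q + sr * S q) * (cr * Sk - sr * Pk)
    - (cr * S q - sr * P q) * (cr * Pk + sr * Sk)); first by ring.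
  by rewrite Aq h; ring.
have E_n0 : E q != 0 by rewrite gt_eqF ?E_gt0.
have L0 : l0 q = 0.
  have := key _ _ _ e0 a0; rewrite F0 F1 !mulr0 subr0 mulr0 addr0 => /eqP.
  by rewrite mulf_eq0 (negbTE E_n0) => /eqP.
have L1 : l1 q = 0.
  have := key _ _ _ e1 a1; rewrite F0 F1 !mulr0 subr0 mulr0 addr0 => /eqP.
  by rewrite mulf_eq0 (negbTE E_n0) => /eqP.
apply: (complex_basis_orthogonal _ F0 F1 L0 L1).
by rewrite sqr_det_phase // mulf_neq0 // subr_eq0 gt_eqF.
Qed.

End ChartPhase.

Section ChartGeometry.
Variable R : realType.
Implicit Types (X : 'rV[R]_2 -> C2 R) (q : 'rV[R]_2).

Lemma mixed_partials X (U : set 'rV[R]_2) q : open U -> smooth_on U X -> U q ->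
  'D_e0 ('D_e1 X) q = 'D_e1 ('D_e0 X) q.
Proof.
move=> oU smX Uq; have [dX sX] := smX 2%N.
have dD v p : U p -> differentiable ('D_v X) p by have [h _] := sX v; exact: h.
have cD v w p : U p -> {for p, continuous ('D_w ('D_v X))}.
  by have [_ h] := sX v; exact: h w p.
apply/esym/rowP => i.
have gradX p : U p -> grad_at (fun p => X p 0 i) p ('D_e0 X p 0 i) ('D_e1 X p 0 i).
  by move=> /dX; exact: grad_at_entry.
have gradD v p : U p -> grad_at (fun p => 'D_v X p 0 i) p
    ('D_e0 ('D_v X) p 0 i) ('D_e1 ('D_v X) p 0 i).
  by move=> /(dD v); exact: grad_at_entry.
have ci v w : {for q, continuous (fun p => 'D_w ('D_v X) p 0 i)}.
  apply: (@continuous_comp _ _ _ ('D_w ('D_v X)) (fun u : C2 R => u 0 i)).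
    exact: cD.
  exact: coord_continuous.
exact: (mixed_derivatives_eq oU Uq gradX (gradD e0) (gradD e1) (ci e0 e1) (ci e1 e0)).
Qed.

Lemma det_coordinate_frame : \det (col_mx e0 e1 : 'M[R]_2) = 1.
Proof.
rewrite det2.
have E1 k : (col_mx e0 e1 : 'M[R]_2) 0 k = (e0 : 'rV[R]_2) 0 k.
  by rewrite -(col_mxEu e0 e1 0 k); congr (col_mx e0 e1 _ _); apply/val_inj.
have E2 k : (col_mx e0 e1 : 'M[R]_2) 1 k = (e1 : 'rV[R]_2) 0 k.
  by rewrite -(col_mxEd e0 e1 0 k); congr (col_mx e0 e1 _ _); apply/val_inj.
by rewrite !E1 !E2 !mxE /= mulr1 mulr0 subr0.
Qed.

Lemma chart_jet X (U : set 'rV[R]_2) (c : R) : open U -> smooth_on U X ->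
  (forall q, U q -> injective (Defs.pushforward X q)) ->
  (forall q, U q -> mean_curvature X q = - normal_proj X q (X q)) ->
  (forall q, U q -> forall a b,
     pullback_kahler_form X q a b = c * volume_form X q a b) ->
  c ^+ 2 < 1 ->
  shrinker_jet X ('D_e0 X) ('D_e1 X) ('D_e0 ('D_e0 X)) ('D_e1 ('D_e0 X))
    ('D_e1 ('D_e1 X)) U c.
Proof.
move=> oU smX inj shr kah c1; have [dX sX] := smX 2%N.
have dD v p : U p -> differentiable ('D_v X) p by have [h _] := sX v; exact: h.
have cD v w p : U p -> {for p, continuous ('D_w ('D_v X))}.
  by have [_ h] := sX v; exact: h w p.
have detE q : U q -> \det (metric_mx X q) = dot ('D_e0 X q) ('D_e0 X q)
    * dot ('D_e1 X q) ('D_e1 X q) - dot ('D_e0 X q) ('D_e1 X q) ^+ 2.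
  move=> /dX dXq; rewrite det2 expr2; congr (_ * _ - _ * _).
  - exact: metric_mxE2.
  - exact: metric_mxE2.
  - exact: metric_mxE2.
  - exact: etrans (metric_mxE2 _ _ dXq) (dotC2C _ _).
have gram q : U q -> 0 < dot ('D_e0 X q) ('D_e0 X q)
    * dot ('D_e1 X q) ('D_e1 X q) - dot ('D_e0 X q) ('D_e1 X q) ^+ 2.
  move=> Uq; rewrite lt_neqAle; apply/andP; split.
    rewrite eq_sym -detE //; have := metric_mx_unit (inj _ Uq).
    by rewrite unitmxE unitfE.
  exact: gram_ge0.
have kahE q : U q -> dot (complexJ ('D_e0 X q)) ('D_e1 X q) =
    c * Num.sqrt (dot ('D_e0 X q) ('D_e0 X q)
    * dot ('D_e1 X q) ('D_e1 X q) - dot ('D_e0 X q) ('D_e1 X q) ^+ 2).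
  move=> Uq; have := kah _ Uq e0 e1; rewrite /volume_form det_coordinate_frame mulr1.
  by rewrite detE // /pullback_kahler_form /kahler_form !pushforwardE //; exact: dX.
apply: (ShrinkerJet oU c1 dX (dD e0) (dD e1) _ _ _ _
  (fun q Uq => mixed_partials oU smX Uq) _ (cD e0 e0) (cD e0 e1) (cD e1 e1)
  gram kahE _) => [q _|q _|q _|q _|q _|q w Uq]; try reflexivity.
have Eq0 := lt0r_neq0 (gram _ Uq).
exact: (shrinker_pairing w (dX _ Uq) erefl erefl erefl (mixed_partials oU smX Uq)
  erefl erefl Eq0 (shr _ Uq)).
Qed.

End ChartGeometry.

(** * The phase on the surface *)

Lemma within_open_continuous (S T : topologicalType) (f : S -> T) (A : set S) p :
  open A -> A p -> {within A, continuous f} -> {for p, continuous f}.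
Proof.
move=> oA Ap cf P nP.
have h1 : nbhs p (fun y => A y -> P (f y)) := (subspace_continuousP _ _).1 cf _ Ap P nP.
have h2 : nbhs p A by exact: open_nbhs_nbhs.
by apply: filterS2 h1 h2 => y /[apply].
Qed.

Section PhaseOnSurface.
Variable R : realType.
Variables (M : oriented_surface R) (x : M -> C2 R) (theta : R).
Hypothesis shr : self_shrinker x.
Hypothesis theta_pi : 0 < theta < pi.
Hypothesis angle : kahler_angle x (fun=> theta).

Local Notation X c := (local_expr x c).
Local Notation img c := (chart_map c @` chart_dom c).

Lemma chart_imgE (c : chart R M) p : chart_dom c p -> img c (chart_map c p).
Proof. by move=> cp; exists p. Qed.

Lemma chart_inv_dom (c : chart R M) q : img c q ->
  chart_dom c (chart_inv c q) /\ chart_map c (chart_inv c q) = q.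
Proof. by move=> [p cp <-]; rewrite chart_mapK. Qed.

Lemma chart_map_cts (c : chart R M) p : chart_dom c p ->
  {for p, continuous (chart_map c)}.
Proof.
move=> cp; apply: (within_open_continuous (chart_dom_open c) cp).
exact: chart_map_continuous.
Qed.

Lemma chart_inv_cts (c : chart R M) q : img c q -> {for q, continuous (chart_inv c)}.
Proof.
move=> cq; apply: (@within_open_continuous _ _ (chart_inv c) (img c)) => //.
  exact: chart_img_open.
exact: chart_inv_continuous.
Qed.

Lemma surface_jet (c : chart R M) : surface_atlas c ->
  shrinker_jet (X c) ('D_e0 (X c)) ('D_e1 (X c)) ('D_e0 ('D_e0 (X c)))
    ('D_e1 ('D_e0 (X c))) ('D_e1 ('D_e1 (X c))) (img c) (cos theta).
Proof.
move=> ac; have [imm eqn] := shr; have [smX inj] := imm c ac.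
apply: chart_jet => //.
- exact: chart_img_open.
- by move=> _ [p cp <-]; exact: inj.
- by move=> _ [p cp <-]; rewrite eqn // /local_expr /= chart_mapK.
- by move=> _ [p cp <-] a b; exact: angle.2.
- rewrite cos2sin2 gtrBl exprn_gt0 //; exact: sin_gt0_pi.
Qed.

Definition chart_re (c : chart R M) q : R := Re_det ('D_e0 (X c) q) ('D_e1 (X c) q).
Definition chart_im (c : chart R M) q : R := Im_det ('D_e0 (X c) q) ('D_e1 (X c) q).
Definition chart_mod c q : R := Num.sqrt (chart_re c q ^+ 2 + chart_im c q ^+ 2).

Lemma chart_sqr_gt0 c q : surface_atlas c -> img c q ->
  0 < chart_re c q ^+ 2 + chart_im c q ^+ 2.
Proof.
move=> ac cq; have jet := surface_jet ac.
rewrite (sqr_det_phase jet cq) mulr_gt0 ?(jet_gram_gt0 jet) //.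
by rewrite subr_gt0 (jet_cos_lt1 jet).
Qed.

Lemma chart_mod_gt0 c q : surface_atlas c -> img c q -> 0 < chart_mod c q.
Proof. by move=> ac cq; rewrite sqrtr_gt0 chart_sqr_gt0. Qed.

Lemma det_linear_comb (a b d e : R) (u v : C2 R) :
  Re_det (a *: u + b *: v) (d *: u + e *: v) = (a * e - b * d) * Re_det u v /\
  Im_det (a *: u + b *: v) (d *: u + e *: v) = (a * e - b * d) * Im_det u v.
Proof. by rewrite /Re_det /Im_det /cx1 /cx2 /cy1 /cy2 !mxE; split; ring. Qed.

Lemma transition_derivative (c d : chart R M) p :
  surface_atlas c -> surface_atlas d -> chart_dom c p -> chart_dom d p ->
  let A := 'J (transition c d) (chart_map c p) in
  forall i : 'I_2, 'D_(delta_mx 0 i) (X c) (chart_map c p) =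
    A i 0 *: 'D_e0 (X d) (chart_map d p) + A i 1 *: 'D_e1 (X d) (chart_map d p).
Proof.
move=> ac ad cp dp A i; set q := chart_map c p.
have [smT _] := surface_atlas_oriented ac ad.
have dT : differentiable (transition c d) q.
  by have [h _] := smT 1%N; apply: h; exists p.
have Tq : transition c d q = chart_map d p by rewrite /transition /= chart_mapK.
have dXd : differentiable (X d) (transition c d q).
  by rewrite Tq; apply: (jet_diff (surface_jet ad)); exists p.
have nE : \forall q' \near q, X c q' = (X d \o transition c d) q'.
  have h : nbhs q (fun q' => chart_dom d (chart_inv c q')).
    apply: (@chart_inv_cts c q (chart_imgE cp) (chart_dom d)).
    apply: open_nbhs_nbhs; split; first exact: chart_dom_open.
    by rewrite /q chart_mapK.
  by apply: filterS h => q' dq'; rewrite /local_expr /transition /= chart_mapK.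
rewrite (near_eq_derive _ nE) deriveE; last exact: differentiable_comp.
rewrite diff_comp //= Tq.
have -> : 'd (transition c d) q (delta_mx 0 i) = A i 0 *: e0 + A i 1 *: e1.
  rewrite -deriveE // derivemxE // -/A -rowE [LHS]rV2E.
  by rewrite !mxE.
rewrite Tq in dXd.
by rewrite linearD !linearZ /= -!deriveE.
Qed.

(** A change of charts multiplies the determinant by its Jacobian, which is
    positive because the surface is oriented: only the modulus changes. *)
Lemma chart_phase_eq (c d : chart R M) p :
  surface_atlas c -> surface_atlas d -> chart_dom c p -> chart_dom d p ->
  chart_re c (chart_map c p) / chart_mod c (chart_map c p) =
    chart_re d (chart_map d p) / chart_mod d (chart_map d p) /\
  chart_im c (chart_map c p) / chart_mod c (chart_map c p) =
    chart_im d (chart_map d p) / chart_mod d (chart_map d p).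
Proof.
move=> ac ad cp dp.
have h := transition_derivative ac ad cp dp; rewrite /= in h.
have [_ det_gt0] := surface_atlas_oriented ac ad.
have k0 : 0 < \det ('J (transition c d) (chart_map c p)) by apply: det_gt0; exists p.
rewrite det2 in k0; set k := (X in 0 < X) in k0.
have [eR eI] := det_linear_comb ('J (transition c d) (chart_map c p) 0 0)
  ('J (transition c d) (chart_map c p) 0 1) ('J (transition c d) (chart_map c p) 1 0)
  ('J (transition c d) (chart_map c p) 1 1) ('D_e0 (X d) (chart_map d p))
  ('D_e1 (X d) (chart_map d p)).
have {}eR : chart_re c (chart_map c p) = k * chart_re d (chart_map d p).
  by rewrite /chart_re (h 0) (h 1) eR.
have {}eI : chart_im c (chart_map c p) = k * chart_im d (chart_map d p).
  by rewrite /chart_im (h 0) (h 1) eI.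
have eM : chart_mod c (chart_map c p) = k * chart_mod d (chart_map d p).
  rewrite /chart_mod eR eI !exprMn -mulrDr sqrtrM ?sqr_ge0 //.
  by rewrite sqrtr_sqr gtr0_norm.
have m0 := chart_mod_gt0 ad (chart_imgE dp).
by rewrite eR eI eM; split; field; rewrite !gt_eqF.
Qed.

Lemma chart_at p : exists2 c : chart R M, surface_atlas c & chart_dom c p.
Proof. exact: surface_atlas_cover. Qed.

Let ch p := sval (cid2 (chart_at p)).
Let ch_atlas p : surface_atlas (ch p). Proof. by rewrite /ch; case: cid2. Qed.
Let ch_dom p : chart_dom (ch p) p. Proof. by rewrite /ch; case: cid2. Qed.

Definition phase_cos p : R :=
  chart_re (ch p) (chart_map (ch p) p) / chart_mod (ch p) (chart_map (ch p) p).
Definition phase_sin p : R :=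
  chart_im (ch p) (chart_map (ch p) p) / chart_mod (ch p) (chart_map (ch p) p).

Lemma phase_sqr p : phase_cos p ^+ 2 + phase_sin p ^+ 2 = 1.
Proof.
have s0 := chart_sqr_gt0 (ch_atlas p) (chart_imgE (ch_dom p)).
rewrite /phase_cos /phase_sin !exprMn -mulrDl exprVn /chart_mod sqr_sqrtr ?ltW //.
by rewrite divff // gt_eqF.
Qed.

Lemma phaseE c p : surface_atlas c -> chart_dom c p ->
  phase_cos p = chart_re c (chart_map c p) / chart_mod c (chart_map c p) /\
  phase_sin p = chart_im c (chart_map c p) / chart_mod c (chart_map c p).
Proof. by move=> ac cp; exact: chart_phase_eq. Qed.

Lemma chart_detE c p : surface_atlas c -> chart_dom c p ->
  chart_re c (chart_map c p) = chart_mod c (chart_map c p) * phase_cos p /\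
  chart_im c (chart_map c p) = chart_mod c (chart_map c p) * phase_sin p.
Proof.
move=> ac cp; have [-> ->] := phaseE ac cp.
have m0 := chart_mod_gt0 ac (chart_imgE cp).
by split; field; rewrite gt_eqF.
Qed.

Lemma phase_continuous : continuous phase_cos /\ continuous phase_sin.
Proof.
have key (c : chart R M) p (f : 'rV[R]_2 -> R) (g : M -> R) : surface_atlas c -> chart_dom c p ->
    {for chart_map c p, continuous f} ->
    (forall p', chart_dom c p' -> g p' = f (chart_map c p')) -> {for p, continuous g}.
  move=> ac cp cf gf.
  have cfc : {for p, continuous (f \o chart_map c)}.
    by apply: continuous_comp cf; exact: chart_map_cts.
  move=> B; rewrite /= gf // => nB.
  have h1 : nbhs p (fun y => B (f (chart_map c y))) := cfc B nB.
  have h2 : nbhs p (chart_dom c).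
    by apply: open_nbhs_nbhs; split=> //; exact: chart_dom_open.
  by apply: filterS2 h1 h2 => y By cy; rewrite /= gf.
have cdet (c : chart R M) q : surface_atlas c -> img c q ->
    [/\ {for q, continuous (chart_re c)}, {for q, continuous (chart_im c)} &
     {for q, continuous (fun q => (chart_mod c q)^-1)}].
  move=> ac cq; have jet := surface_jet ac.
  have d0 := jet_diff0 jet cq; have d1 := jet_diff1 jet cq.
  have cR := grad_at_continuous (grad_at_Re_det d0 d1).
  have cI := grad_at_continuous (grad_at_Im_det d0 d1).
  split=> //; apply: cont_atV; first by rewrite gt_eqF ?chart_mod_gt0.
  apply: (@continuous_comp _ _ _ (fun q => chart_re c q ^+ 2 + chart_im c q ^+ 2) Num.sqrt).
    exact: cont_atD (cont_atM cR cR) (cont_atM cI cI).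
  exact: sqrt_continuous.
split=> p; have ac := ch_atlas p; have cp := ch_dom p;
  have [cR cI cm] := cdet _ _ ac (chart_imgE cp).
  apply: (key _ _ _ _ ac cp (cont_atM cR cm)) => p' cp'.
  by have [h _] := phaseE ac cp'.
apply: (key _ _ _ _ ac cp (cont_atM cI cm)) => p' cp'.
by have [_ h] := phaseE ac cp'.
Qed.

(** In a chart at [p0], close to [p0], the rotated determinant has positive real
    part and nonpositive imaginary part, since the angle is at most [a p0] and close
    to it.  By [phase_rigidity] its imaginary part vanishes near [p0], that is,
    sin (a - a p0) = 0. *)
Lemma lifted_phase_locally_constant (a : M -> R) p0 : continuous a ->
  (forall p, cos (a p) = phase_cos p /\ sin (a p) = phase_sin p) ->
  (forall p, a p <= a p0) -> \forall p \near p0, a p = a p0.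
Proof.
move=> ca aE amax; have ac := ch_atlas p0; have cp := ch_dom p0.
move: (ch p0) ac cp => c ac cp; set q0 := chart_map c p0.
have cq0 : img c q0 by exact: chart_imgE.
pose near_a := [set q | img c q /\ `|a (chart_inv c q) - a p0| < 1].
have /nbhs_interior nV : nbhs q0 near_a.
  have h1 : nbhs q0 (img c).
    by apply: open_nbhs_nbhs; split=> //; exact: chart_img_open.
  have h2 : nbhs q0 (fun q => `|a p0 - a (chart_inv c q)| < 1).
    have caq : {for q0, continuous (a \o chart_inv c)}.
      by apply: continuous_comp (chart_inv_cts cq0) _; exact: ca.
    have -> : a p0 = (a \o chart_inv c) q0 by rewrite /= /q0 chart_mapK.
    have /(_ _) h := cvgr_dist_lt (a \o chart_inv c) ((a \o chart_inv c) q0) caq _ (@ltr01 R).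
    exact: h.
  by apply: filterS2 h1 h2 => q cq h; split=> //; rewrite distrC.
pose V := interior near_a.
have oV : open V by exact: open_interior.
have V0 : V q0 by exact: nbhs_singleton nV.
have Vn q : V q -> near_a q by exact: interior_subset.
have VU : V `<=` img c by move=> q /Vn[].
have jet := shrinker_jetS oV VU (surface_jet ac).
have det_a q : V q -> chart_re c q = chart_mod c q * cos (a (chart_inv c q)) /\
    chart_im c q = chart_mod c q * sin (a (chart_inv c q)).
  move=> /VU cq; have [dq mq] := chart_inv_dom cq.
  by have := chart_detE ac dq; rewrite mq; have [-> ->] := aE (chart_inv c q).
have rot q (s := a p0) (t := a (chart_inv c q)) : V q ->
    cos s * chart_re c q + sin s * chart_im c q = chart_mod c q * cos (t - s) /\
    cos s * chart_im c q - sin s * chart_re c q = chart_mod c q * sin (t - s).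
  by move=> /det_a[-> ->]; rewrite cosB sinB -/t; split; ring.
have pi1 : 1 <= pi / 2 :> R := pihalf_ge1 R.
have nz : \forall q \near q0,
    cos (a p0) * chart_im c q - sin (a p0) * chart_re c q = 0.
  apply: (phase_rigidity jet V0 (cos2Dsin2 _)).
  - move=> q Vq; have [-> _] := rot q Vq; have [cq h] := Vn _ Vq.
    rewrite mulr_gt0 ?chart_mod_gt0 //; apply: cos_gt0_pihalf.
    by rewrite -ltr_norml (lt_le_trans h).
  - move=> q Vq; have [_ ->] := rot q Vq; have [cq h] := Vn _ Vq.
    rewrite pmulr_rle0 ?chart_mod_gt0 // -oppr_ge0 -sinN opprB sin_ge0_pi //.
    rewrite subr_ge0 amax /= (le_trans (ler_norm _)) // distrC ltW // (lt_le_trans h) //.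
    by rewrite (le_trans _ (pi_ge2 R)) // ler1n.
  - by have [_ ->] := rot q0 V0; rewrite /q0 chart_mapK // subrr sin0 mulr0.
have h1 : nbhs p0 (fun p => V (chart_map c p) /\
    cos (a p0) * chart_im c (chart_map c p) - sin (a p0) * chart_re c (chart_map c p) = 0).
  have h : nbhs q0 (fun q => V q /\
      cos (a p0) * chart_im c q - sin (a p0) * chart_re c q = 0) by exact: filterI nV nz.
  exact: (chart_map_cts cp h).
have h2 : nbhs p0 (chart_dom c).
  by apply: open_nbhs_nbhs; split=> //; exact: chart_dom_open.
apply: filterS2 h1 h2 => p [Vp hp] dp.
have [cq h] := Vn _ Vp; have [_] := rot _ Vp; rewrite hp chart_mapK // in h *.
move/eqP; rewrite eq_sym mulf_eq0 gt_eqF ?chart_mod_gt0 //= => /eqP sin0.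
apply/eqP; rewrite eq_le amax /= -subr_ge0 leNgt; apply/negP => neg.
have : 0 < sin (a p0 - a p).
  apply: sin_gt0_pi; rewrite -oppr_lt0 opprB neg /= (le_lt_trans (ler_norm _)) //.
  by rewrite distrC (lt_le_trans h) // (le_trans _ (pi_ge2 R)) // ler1n.
by rewrite -[a p0 - a p]opprB sinN sin0 oppr0 ltxx.
Qed.

(** At a maximum of the distance to the origin the position vector is normal. *)
Lemma center_at_max (a : R) p1 :
  (forall p, cos a = phase_cos p /\ sin a = phase_sin p) ->
  (forall p, dot (x p) (x p) <= dot (x p1) (x p1)) -> x p1 = 0.
Proof.
move=> aE xmax; have ac := ch_atlas p1; have cp := ch_dom p1.
move: (ch p1) ac cp => c ac cp; set q1 := chart_map c p1.
have cq1 : img c q1 by exact: chart_imgE.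
have jet := surface_jet ac.
have nU : nbhs q1 (img c) by exact: open_nbhs_nbhs (conj (jet_open jet) cq1).
have Xq1 : X c q1 = x p1 by rewrite /local_expr /= /q1 chart_mapK.
have grad2 q : img c q -> grad_at (fun p => dot (X c p) (X c p)) q
    (2 * dot (X c q) ('D_e0 (X c) q)) (2 * dot (X c q) ('D_e1 (X c) q)).
  move=> cq; have dXq := jet_diff jet cq.
  by apply: grad_at_eq (grad_at_dot dXq dXq) _ _; rewrite [dot ('D__ _ _) _]dotC2C; ring.
have ngrad : \forall q \near q1, grad_at (fun p => dot (X c p) (X c p)) q
    (2 * dot (X c q) ('D_e0 (X c) q)) (2 * dot (X c q) ('D_e1 (X c) q)).
  exact: filterS nU.
have nmax : \forall q \near q1, dot (X c q) (X c q) <= dot (X c q1) (X c q1).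
  by apply: filterE => q; rewrite Xq1; exact: xmax.
have [h0 h1 _ _] := grad_pos jet cq1.
have g0 := grad_atM (grad_atC 2 q1) h0; have g1 := grad_atM (grad_atC 2 q1) h1.
have [z0 _] := second_derivative_max e0 ngrad g0 g1 nmax.
have [z1 _] := second_derivative_max e1 ngrad g0 g1 nmax.
rewrite -Xq1; apply: (center_of_constant_phase jet cq1 (cos2Dsin2 a)).
- apply: filterS nU => q cq; have [dq mq] := chart_inv_dom cq.
  have [eR eI] := chart_detE ac dq; rewrite mq in eR eI.
  have [e e'] := aE (chart_inv c q).
  rewrite -/(chart_re c q) -/(chart_im c q) eR eI -e -e'; ring.
- move: z0; rewrite !mxE /= mul1r mul0r addr0 => /eqP.
  by rewrite mulf_eq0 pnatr_eq0 => /eqP.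
- move: z1; rewrite !mxE /= mul1r mul0r add0r => /eqP.
  by rewrite mulf_eq0 pnatr_eq0 => /eqP.
Qed.

Lemma surface_map_continuous : continuous x.
Proof.
move=> p; have ac := ch_atlas p; have cp := ch_dom p.
move: (ch p) ac cp => c ac cp B.
have E p' : chart_dom c p' -> X c (chart_map c p') = x p'.
  by move=> cp'; rewrite /local_expr /= chart_mapK.
rewrite -E // => nB.
have cX : {for chart_map c p, continuous (X c)}.
  exact: differentiable_continuous (jet_diff (surface_jet ac) (chart_imgE cp)).
have h1 : nbhs p (fun y => B (X c (chart_map c y))) := chart_map_cts cp (cX B nB).
have h2 : nbhs p (chart_dom c).
  by apply: open_nbhs_nbhs; split=> //; exact: chart_dom_open.
by apply: filterS2 h1 h2 => y By cy; rewrite /= -E.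
Qed.

Lemma surface_map_not_zero (p0 : M) : ~ forall p, x p = 0.
Proof.
move=> x0; have ac := ch_atlas p0; have cp := ch_dom p0.
have jet := surface_jet ac; have := jet_gram_gt0 jet (chart_imgE cp).
have D0 v : 'D_v (X (ch p0)) (chart_map (ch p0) p0) = 0.
  rewrite (_ : X (ch p0) = cst 0) ?derive_cst //.
  by apply/funext => q; rewrite /local_expr /= x0.
have z (v : C2 R) : dot 0 v = 0.
  by rewrite /dot big1 // => i _; rewrite mxE mul0r.
by rewrite !D0 !z mulr0 expr0n subr0 ltxx.
Qed.

End PhaseOnSurface.

Theorem corollary1p4 (R : realType) :
  ~ exists (M : oriented_surface R) (x : M -> C2 R) (theta : R),
      [/\ homeomorphic_to_set M (@sphere2 R), self_shrinker x,
          0 < theta < pi & kahler_angle x (fun _ : M => theta)].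
Proof.
move=> [M [x [theta [MS shr theta_pi angle]]]].
have hM := @surface_hausdorff _ M.
have cM := sphere_compact MS.
have [p0 _] : [set: M] !=set0.
  by have [G _] := disk_param MS; exists (G 0).
have [cc cs] := phase_continuous shr theta_pi angle.
have [a ca aE] := sphere_phase_lift hM MS cc cs (phase_sqr shr theta_pi angle).
have M0 : [set: M] !=set0 by exists p0.
have [pa _ amax] := compact_EVT_max M0 cM (continuous_subspaceT ca).
have {}amax p : a p <= a pa by apply: amax; rewrite inE.
have aconst p : a p = a pa.
  have : [set p | a p = a pa] = setT.
    apply: (sphere_clopen MS).
    - rewrite openE => p' /= ap'; have amax' p'' : a p'' <= a p' by rewrite ap'.
      have := lifted_phase_locally_constant shr theta_pi angle ca aE amax'.
      by apply: filterS => p'' ap''; rewrite /= ap''.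
    - have -> : [set p | a p = a pa] = a @^-1` [set a pa] by [].
      apply: preimage_closed; first by move=> ? _; exact: ca.
      exact: closed_eq.
    - by exists pa.
  by move=> /seteqP[_ /(_ p I)].
have cx := surface_map_continuous shr theta_pi angle.
have cxx : continuous (fun p => dot (x p) (x p)).
  by move=> p; exact: cont_at_dot (cx p) (cx p).
have [p1 _ xmax] := compact_EVT_max M0 cM (continuous_subspaceT cxx).
have {}xmax p : dot (x p) (x p) <= dot (x p1) (x p1) by apply: xmax; rewrite inE.
have aE' p : cos (a pa) = phase_cos x p /\ sin (a pa) = phase_sin x p.
  by rewrite -(aconst p); exact: aE.
have x1 := center_at_max shr theta_pi angle aE' xmax.
apply: (surface_map_not_zero shr theta_pi angle p0) => p.
apply: dot_eq0; apply/eqP; rewrite eq_le (le_trans (xmax p)).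
  by apply: sumr_ge0 => i _; rewrite -expr2 sqr_ge0.
by rewrite x1 /dot big1 // => i _; rewrite mxE mul0r.
Qed.
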